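(* Let $\mathcal A$ be a unital C$^*$-algebra, $\mathcal H$ a finitely or countably generated Hilbert $\mathcal A$-module, $J$ a finite or countable index set, $K\in Hom^*_{\mathcal A}(\mathcal H)$, and let $\{f_j\}_{j\in J}\subseteq\mathcal H$ be a $*$-Bessel sequence. Let $T:\ell^2(\mathcal A)\to\mathcal H$ be the operator $T(\{g_j\}_{j\in J})=\sum_{j\in J}g_jf_j$ and suppose that $\overline{R(T^* )}$ is orthogonally complemented in $\ell^2(\mathcal A)$. Then $\{f_j\}_{j\in J}$ is a $*$-atomic system for $K$ if and only if there exists an adjointable operator $L:\ell^2(\mathcal A)\to\mathcal H$ such that $L(e_j)=f_j$ for every $j\in J$ and $R(K)\subseteq R(L)$, where $\{e_j\}_{j\in J}$ is the standard orthonormal basis of $\ell^2(\mathcal A)$.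
   Context: Hilbert $\mathcal A$-modules are left modules with $\mathcal A$-valued inner product that is $\mathcal A$-linear in the first variable and satisfies $\langle f,g\rangle=\langle g,f\rangle^*$. $Hom^*_{\mathcal A}(\mathcal H)$ is the C$^*$-algebra of adjointable operators on $\mathcal H$. $\ell^2(\mathcal A)$ is the Hilbert $\mathcal A$-module of sequences $\{A_j\}_{j\in J}$ in $\mathcal A$ with $\sum_j A_jA_j^*$ norm convergent, with $\langle\{A_j\},\{B_j\}\rangle=\sum_jA_jB_j^*$; $e_j$ is the sequence with $1_{\mathcal A}$ in position $j$ and $0$ elsewhere. $R(\cdot)$ denotes range; a closed submodule $\mathcal M$ of a Hilbert module $\mathcal E$ is orthogonally complemented if $\mathcal E=\mathcal M\oplus\mathcal M^\perp$. An element of $\mathcal A$ is strictly nonzero if $0$ is not in its spectrum. A sequence $\{f_j\}_{j\in J}\subseteq \mathcal H$ is a $*$-Bessel sequence if there is a strictly nonzero $B\in\mathcal A$ with $\sum_{j}\langle f,f_j\rangle\langle f_j,f\rangle\le B\langle f,f\rangle B^*$ for all $f\in\mathcal H$ (the sum converging in norm). It is a $*$-atomic system for $K$ if it is a $*$-Bessel sequence and there is a strictly nonzero $C\in\mathcal A$ such that for every $f\in\mathcal H$ there is $a_f=\{a_j\}_{j\in J}\in\ell^2(\mathcal A)$ with $K(f)=\sum_{j}a_jf_j$ and $\langle a_f,a_f\rangle\le C\langle f,f\rangle C^*$. *)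

(* Defs.v *)
From HB Require Import structures.
From mathcomp Require Import all_boot all_order all_algebra.
From mathcomp Require Import finmap complex.
From mathcomp Require Import all_classical all_reals all_analysis.
From mathcomp Require Export summability.

Set Implicit Arguments.
Unset Strict Implicit.
Unset Printing Implicit Defensive.

Import Order.TTheory GRing.Theory Num.Theory.
Import numFieldNormedType.Exports.

Local Open Scope classical_set_scope.
Local Open Scope ring_scope.
Local Open Scope complex_scope.

(** The norm is a field of the structure rather than the one of
    [Num.NormedZmodule], which MathComp cannot join with rings other than
    [numDomainType]s.  By [cnorm_entourage] the topology is
    the one of the norm. *)

HB.mixin Record isCStarAlgebra (R : realType) A
    & GRing.Algebra R[i] A & Uniform A := {
  cnorm : A -> R ;
  cnormD : forall a b : A, cnorm (a + b) <= cnorm a + cnorm b ;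
  cnormZ : forall (k : R[i]) (a : A), cnorm (k *: a) = Normc.normc k * cnorm a ;
  cnorm_eq0 : forall a : A, cnorm a = 0 -> a = 0 ;
  cnormM : forall a b : A, cnorm (a * b) <= cnorm a * cnorm b ;
  cnorm_entourage : entourage =
    filter_from [set e : R | 0 < e]
      (fun e => [set ab : A * A | cnorm (ab.1 - ab.2) < e]) ;
  cstar_complete : forall F : set_system A,
    ProperFilter F -> cauchy F -> exists a : A, F --> a ;
  star : A -> A ;
  starD : forall a b : A, star (a + b) = star a + star b ;
  starZ : forall (k : R[i]) (a : A), star (k *: a) = k^* *: star a ;
  starM : forall a b : A, star (a * b) = star b * star a ;
  starK : forall a : A, star (star a) = a ;
  cnorm_star : forall a : A, cnorm (star a * a) = cnorm a ^+ 2
}.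

#[short(type="cstarAlgType")]
HB.structure Definition CStarAlgebra (R : realType) :=
  {A of GRing.Algebra R[i] A & Uniform A & isCStarAlgebra R A}.

Section CStarAlgebraTheory.
Context (R : realType) (A : cstarAlgType R).
Implicit Types a b : A.

Definition invertible a := exists b, a * b = 1 /\ b * a = 1.

Definition spectrum a : set R[i] := [set z | ~ invertible (a - z%:A)].

Definition strictly_nonzero a := ~ spectrum a 0.

(* In [R[i]], [0 <= z] says that z is real and nonnegative. *)
Definition cstar_nneg a := star a = a /\ spectrum a `<=` [set z | 0 <= z].

Definition cstar_le a b := cstar_nneg (b - a).

End CStarAlgebraTheory.

(** The underlying complex Banach space is the library's.  The action of [A] is
    a field [act], written [a *; f], because a type cannot carry both a
    [GRing.Lmodule A] and a [NormedModule R[i]] structure. *)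

Reserved Notation "a *; f" (at level 40).

HB.mixin Record isHilbertModule (R : realType) (A : cstarAlgType R) H
    & CompleteNormedModule R[i] H := {
  act : A -> H -> H ;
  actDl : forall (a b : A) (f : H), act (a + b) f = act a f + act b f ;
  actDr : forall (a : A) (f g : H), act a (f + g) = act a f + act a g ;
  actA : forall (a b : A) (f : H), act a (act b f) = act (a * b) f ;
  act1 : forall f : H, act 1 f = f ;
  actZl : forall (k : R[i]) (a : A) (f : H), act (k *: a) f = k *: act a f ;
  inner : H -> H -> A ;
  innerDl : forall f g h : H, inner (f + g) h = inner f h + inner g h ;
  inner_act : forall (a : A) (f g : H), inner (act a f) g = a * inner f g ;
  inner_star : forall f g : H, inner f g = star (inner g f) ;
  inner_nneg : forall f : H, cstar_nneg (inner f f) ;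
  inner_eq0 : forall f : H, inner f f = 0 -> f = 0 ;
  inner_norm : forall f : H, `|f| = (Num.sqrt (cnorm (inner f f)))%:C
}.

#[short(type="hilbertModType")]
HB.structure Definition HilbertModule (R : realType) (A : cstarAlgType R) :=
  {H of CompleteNormedModule R[i] H & isHilbertModule R A H}.

Notation "a *; f" := (act a f) : ring_scope.

Section HilbertModuleTheory.
Context (R : realType) (A : cstarAlgType R).

Definition lin_span (H : hilbertModType A) (S : set H) : set H :=
  [set y | exists n (a : 'I_n -> A) (x : 'I_n -> H),
     (forall i, S (x i)) /\ y = \sum_(i < n) a i *; x i].

Definition finitely_generated (H : hilbertModType A) :=
  exists S : set H, finite_set S /\ lin_span S = setT.

Definition countably_generated (H : hilbertModType A) :=
  exists S : set H, countable S /\ closure (lin_span S) = setT.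

Definition is_adjoint (E F : hilbertModType A) (T : E -> F) (S : F -> E) :=
  forall f g, inner (T f) g = inner f (S g).

Definition adjointable (E F : hilbertModType A) (T : E -> F) :=
  exists S, is_adjoint T S.

End HilbertModuleTheory.

(** Families are summed along the finite subsets of the index set, so that no
    enumeration has to be chosen: every [countType], finite or not, can serve
    as [J]. *)

Section Sums.
Context (V : PreTopologicalZmodule.type) (J : countType).
Implicit Types x : J -> V.

Definition has_sum x (l : V) := partial_sum x @ totally --> l.

Definition converges x := exists l, has_sum x l.

(* The junk value 0 stands for the sum of a family that does not converge. *)
Definition total x : V := xget 0 [set l | has_sum x l].

End Sums.

(** The Hilbert module l2(A) is handled as a set of families [J -> A] with
    pointwise operations.  Operators on it are functions on [J -> A] of which
    only the values on [l2] matter. *)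

Section EllTwo.
Context (R : realType) (A : cstarAlgType R) (J : countType).
Implicit Types (a b : J -> A) (M : set (J -> A)).

Definition l2 : set (J -> A) := [set a | converges (fun j => a j * star (a j))].

Definition l2_inner a b : A := total (fun j => a j * star (b j)).

Definition l2_norm a : R := Num.sqrt (cnorm (l2_inner a a)).

Definition l2_basis (j : J) : J -> A := fun i => (i == j)%:R.

Definition l2_closure M : set (J -> A) :=
  [set a | l2 a /\
     forall e : R, 0 < e -> exists2 b, M b & l2_norm (a - b) < e].

Definition l2_orthogonal M : set (J -> A) :=
  [set a | l2 a /\ forall b, M b -> l2_inner a b = 0].

(* The sum of M and its orthogonal is automatically direct. *)
Definition l2_complemented M :=
  forall a, l2 a -> exists b c, [/\ M b, l2_orthogonal M c & a = b + c].

Section Operators.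
Context (H : hilbertModType A).

Definition l2_is_adjoint (T : (J -> A) -> H) (S : H -> J -> A) :=
  (forall f, l2 (S f)) /\
  (forall a f, l2 a -> inner (T a) f = l2_inner a (S f)).

Definition l2_adjointable (T : (J -> A) -> H) := exists S, l2_is_adjoint T S.

(* The adjoint of T, which is unique; the zero map if T has none. *)
Definition l2_adjoint (T : (J -> A) -> H) : H -> J -> A :=
  xget (fun _ _ => 0) [set S | l2_is_adjoint T S].

End Operators.

End EllTwo.
Arguments l2 {R} A J.
Arguments l2_basis {R} A {J} j.

Section Frames.
Context (R : realType) (A : cstarAlgType R) (H : hilbertModType A).
Context (J : countType).

Definition star_bessel (f : J -> H) :=
  exists B : A, strictly_nonzero B /\
    forall x : H,
      let s := fun j => inner x (f j) * inner (f j) x in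
      converges s /\ cstar_le (total s) (B * inner x x * star B).

Definition star_atomic_system (K : H -> H) (f : J -> H) :=
  star_bessel f /\
  exists C : A, strictly_nonzero C /\
    forall x : H, exists a : J -> A,
      [/\ l2 A J a, has_sum (fun j => a j *; f j) (K x)
        & cstar_le (l2_inner a a) (C * inner x x * star C)].

Definition synthesis (f : J -> H) (g : J -> A) : H :=
  total (fun j => g j *; f j).

End Frames.

(* Main.v *)
From Pilot Require Import Defs.
From mathcomp Require Import all_boot all_order all_algebra.
From mathcomp Require Import finmap complex.
From mathcomp Require Import all_classical all_reals all_analysis.
From mathcomp Require Import ring lra.
From Stdlib Require Ncring Ncring_tac.

(* The synthesis operator T is adjointable, its adjoint being the analysis
   operator x |-> (<x, f_j>)_j, and any adjointable L with L e_j = f_j has the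
   same adjoint, so it coincides with T. Hence a *-atomic system yields L = T.

   Conversely, let R(K) be included in R(T) and let M be the closure of R(T^* ).
   As M is complemented, each K x is T a for a unique a in M. The functionals
   y |-> <K y, z>, for |T^* z| <= 1, are pointwise bounded because <K y, z> =
   <b, T^* z> whenever K y = T b; by uniform boundedness |<K y, z>| <= c |y|
   |T^* z|, and letting T^* z approach a gives |a| <= c |x|. Since x |-> a is
   A-linear, <a, a> <= k <x, x> for every k > c^2.

   Spectral theory is replaced by square roots: if |1 - p| < 1, then p has a
   square root, obtained as a fixed point, which commutes with the commutant
   of p. Positivity becomes the norm condition [pos], and [pos] is shown to be
   equivalent to having a nonnegative spectrum. *)

Set Implicit Arguments.
Unset Strict Implicit.
Unset Printing Implicit Defensive.

Import Order.TTheory GRing.Theory Num.Theory.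
Import numFieldNormedType.Exports.
(* [total] would otherwise be the one of [ssrbool]. *)
Import Pilot.Defs.

Local Open Scope classical_set_scope.
Local Open Scope ring_scope.
Local Open Scope complex_scope.

(** * Norms and families *)

Section CompleteNorm.
Context (R : realType) (V : PreTopologicalZmodule.type).

(* The norm of a C*-algebra is not the library's, and the one of a Hilbert
   module takes its values in [R[i]]; this is what they have in common. *)
Record complete_norm (N : V -> R) : Prop := CompleteNorm {
  norm_zero : N 0 = 0 ;
  norm_eq0 : forall x, N x = 0 -> x = 0 ;
  norm_tri : forall x y, N (x + y) <= N x + N y ;
  norm_opp : forall x, N (- x) = N x ;
  norm_cvg : forall (F : set_system V) l, Filter F ->
    (F --> l) <-> (forall e, 0 < e -> F [set x | N (x - l) < e]) ;
  norm_complete : forall F : set_system V, ProperFilter F ->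
    (forall e, 0 < e -> exists x, F [set y | N (y - x) < e]) ->
    exists l : V, F --> l
}.

Variable N : V -> R.
Hypothesis hN : complete_norm N.

Lemma norm_ge0 x : 0 <= N x.
Proof.
have := norm_tri hN x (- x); rewrite subrr (norm_zero hN) (norm_opp hN); lra.
Qed.

Lemma norm_sub x y : N (x - y) = N (y - x).
Proof. by rewrite -(norm_opp hN) opprB. Qed.

Lemma norm_subD x y z : N (x - z) <= N (x - y) + N (y - z).
Proof. by rewrite -[x - z](subrKA y) (norm_tri hN). Qed.

Lemma norm_sub_eq x y : (forall e, 0 < e -> N (x - y) <= e) -> x = y.
Proof.
move=> h; apply/eqP; rewrite -subr_eq0; apply/eqP/(norm_eq0 hN)/eqP.
rewrite eq_le norm_ge0 andbT.
by apply/ler_addgt0Pl => e e0; rewrite addr0 h.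
Qed.

Definition seq_lim (u : nat -> V) l :=
  forall e, 0 < e -> exists n, forall m, (n <= m)%N -> N (u m - l) < e.

Lemma seq_cauchy_lim (u : nat -> V) :
  (forall e, 0 < e -> exists n, forall m, (n <= m)%N -> N (u m - u n) < e) ->
  exists l, seq_lim u l.
Proof.
move=> cu.
have [e e0|l ul] := @norm_complete _ hN (u @ \oo) _.
  have [n hn] := cu e e0.
  by exists (u n), n => // m /= /hn.
exists l => e e0.
have [+ _] := norm_cvg hN (F := u @ \oo) l _.
by move=> /(_ ul e e0)[n _ hn]; exists n => m nm; exact: hn.
Qed.

Lemma geometric_lim (u : nat -> V) (C r : R) : 0 <= r < 1 ->
  (forall n, N (u n.+1 - u n) <= C * r ^+ n) ->
  exists l, seq_lim u l.
Proof.
move=> /andP[r0 r1] hu.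
have C0 : 0 <= C by rewrite (le_trans (norm_ge0 _) (le_trans (hu 0%N) _))// expr0 mulr1.
have r1' : 0 < 1 - r by rewrite subr_gt0.
(* The factor [1 - r ^+ k] comes from the finite geometric sum; keeping it makes the induction on
   [k] close. *)
have hnk n k : N (u (n + k)%N - u n) <= C * r ^+ n * (1 - r ^+ k) / (1 - r).
  elim: k => [|k ih]; first by rewrite addn0 subrr (norm_zero hN) expr0 subrr mulr0 mul0r.
  rewrite (le_trans (norm_subD _ (u (n + k)%N) _))// addnS.
  rewrite (le_trans (lerD (hu _) ih))//.
  rewrite -(ler_pM2r r1') mulrDl !divfK ?gt_eqF// exprD exprS.
  by rewrite le_eqVlt; apply/orP; left; apply/eqP; ring.
have hnm n m : (n <= m)%N -> N (u m - u n) <= C * r ^+ n / (1 - r).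
  move=> nm; rewrite -(subnKC nm) (le_trans (hnk _ _))//.
  rewrite ler_pM2r ?invr_gt0// ler_piMr ?mulr_ge0 ?exprn_ge0//.
  by rewrite lerBlDr lerDl exprn_ge0.
have small e : 0 < e -> exists n, C * r ^+ n / (1 - r) < e.
  move=> e0.
  have : (fun n => C / (1 - r) * r ^+ n) @ \oo --> C / (1 - r) * 0.
    by apply: cvgMr; apply: cvg_expr; rewrite ger0_norm.
  rewrite mulr0 => /cvgrPdist_lt/(_ e e0)[n _ hn]; exists n.
  have := hn n (leqnn n); rewrite /= sub0r normrN => /(le_lt_trans (ler_norm _)).
  by rewrite mulrAC.
apply: seq_cauchy_lim => e e0; have [n hn] := small e e0.
by exists n => m nm; exact: le_lt_trans (hnm _ _ nm) hn.
Qed.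

(** Banach's fixed point theorem on a sequentially closed set [Q]. It produces both Neumann inverses
    and square roots. *)
Lemma contraction_fixpoint (Q : V -> Prop) (f : V -> V) (x0 : V) (r : R) :
  0 <= r < 1 -> Q x0 -> (forall x, Q x -> Q (f x)) ->
  (forall x y, Q x -> Q y -> N (f x - f y) <= r * N (x - y)) ->
  (forall u l, (forall n : nat, Q (u n)) -> seq_lim u l -> Q l) ->
  exists2 l, Q l & f l = l.
Proof.
move=> r01 Q0 Qf fr Qlim.
pose u n := iter n f x0.
have Qu n : Q (u n) by elim: n => // n; exact: Qf.
have [|l ul] := @geometric_lim u (N (f x0 - x0)) r r01.
  elim=> [|n ih]; first by rewrite expr0 mulr1.
  apply: le_trans (fr _ _ (Qu n.+1) (Qu n)) _.
  by rewrite exprS mulrCA ler_wpM2l//; case/andP: r01.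
have Ql := Qlim _ _ Qu ul.
exists l => //; apply: norm_sub_eq => e e0.
have e2 : 0 < e / 2 by rewrite divr_gt0.
have [n hn] := ul _ e2.
rewrite (le_trans (norm_subD _ (u n.+1) _))//.
have := hn _ (leqnn n); have := hn _ (leqnSn n).
have := fr _ _ Ql (Qu n); rewrite -[f (u n)]/(u n.+1) (norm_sub l).
have := norm_ge0 (u n - l); case/andP: r01; nra.
Qed.

End CompleteNorm.

Lemma sum_fsetU (V : zmodType) (J : choiceType) (x : J -> V) (F G : {fset J}) :
  fdisjoint F G ->
  \sum_(j <- fsetU F G) x j = \sum_(j <- F) x j + \sum_(j <- G) x j.
Proof.
move=> dFG; rewrite -big_cat; apply: perm_big; apply: uniq_perm => //.
- rewrite cat_uniq !fset_uniq/= andbT; apply/hasPn => j jG /=.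
  by apply/negP => jF; move/fdisjointP: dFG => /(_ j jF)/negP.
- by move=> j; rewrite inE mem_cat.
Qed.

(** * Unordered sums of families *)

Section FamilySums.
Context (R : realType) (V : PreTopologicalZmodule.type) (N : V -> R).
Context (J : countType).
Hypothesis hN : complete_norm N.
Implicit Types (x y : J -> V) (F G : {fset J}).

Lemma partial_sumE x F : partial_sum x F = \sum_(j <- F) x j.
Proof. by rewrite /partial_sum big_seq_fsetE. Qed.

Lemma has_sumP x l : has_sum x l <->
  forall e, 0 < e -> exists G, forall F, fsubset G F ->
    N (\sum_(j <- F) x j - l) < e.
Proof.
have tf := @totally_filter J.
apply: (iff_trans (norm_cvg hN _ _)); split=> h e /h.
- by case=> G _ hG; exists G => F /hG /=; rewrite partial_sumE.
- by case=> G hG; exists G => // F /hG /=; rewrite partial_sumE.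
Qed.

Lemma has_sum_unique x l l' : has_sum x l -> has_sum x l' -> l = l'.
Proof.
move=> /has_sumP h /has_sumP h'; apply: (norm_sub_eq hN) => e e0.
have e2 : 0 < e / 2 by rewrite divr_gt0.
have [G hG] := h _ e2; have [G' hG'] := h' _ e2.
have := hG _ (fsubsetUl G G'); have := hG' _ (fsubsetUr G G').
set s := \sum_(j <- _) _; rewrite (norm_sub hN s l).
have := norm_subD hN l s l'; lra.
Qed.

Lemma total_eq x l : has_sum x l -> total x = l.
Proof. by move=> h; apply: xget_unique => // l' /has_sum_unique; apply. Qed.

Lemma converges_total x : converges x -> has_sum x (total x).
Proof. by case=> l h; rewrite (total_eq h). Qed.

Lemma has_sumD x y l l' :
  has_sum x l -> has_sum y l' -> has_sum (fun j => x j + y j) (l + l').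
Proof.
move=> /has_sumP h /has_sumP h'; apply/has_sumP => e e0.
have e2 : 0 < e / 2 by rewrite divr_gt0.
have [G hG] := h _ e2; have [G' hG'] := h' _ e2.
exists (fsetU G G') => F; rewrite fsubUset => /andP[/hG + /hG'].
rewrite big_split/= opprD addrACA.
set u := _ - l; set v := _ - l'.
have := norm_tri hN u v; lra.
Qed.

Lemma has_sum_cauchy x : converges x -> forall e, 0 < e ->
  exists G, forall F, fdisjoint G F -> N (\sum_(j <- F) x j) < e.
Proof.
move=> [l /has_sumP h] e e0.
have e2 : 0 < e / 2 by rewrite divr_gt0.
have [G hG] := h _ e2; exists G => F dGF.
have := hG _ (fsubset_refl G); have := hG _ (fsubsetUl G F).
rewrite sum_fsetU//; set u := \sum_(_ <- _) _; set v := \sum_(_ <- _) _.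
have := norm_tri hN (u + v - l) (l - u).
rewrite (norm_sub hN l u) addrA subrK [u + v]addrC addrK; lra.
Qed.

Lemma cauchy_has_sum x :
  (forall e, 0 < e ->
    exists G, forall F, fdisjoint G F -> N (\sum_(j <- F) x j) < e) ->
  converges x.
Proof.
move=> h; have tf := @totally_filter J.
apply: (@norm_complete _ _ _ hN (partial_sum x @ totally)) => e e0.
have [G hG] := h e e0; exists (\sum_(j <- G) x j), G => //= F GF.
have dGF : fdisjoint G (fsetD F G) by apply/fdisjointP => j jG; rewrite inE jG.
have -> : F = fsetU G (fsetD F G).
  apply/fsetP => j; rewrite !inE.
  by case: (boolP (j \in G)) => // /(fsubsetP GF) ->.
by rewrite /= partial_sumE sum_fsetU// addrAC subrr add0r hG.
Qed.

Lemma has_sum_single x j : (forall i, i != j -> x i = 0) -> has_sum x (x j).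
Proof.
move=> h; apply/has_sumP => e e0; exists [fset j]%fset => F.
rewrite fsub1set => jF; rewrite (big_fsetD1 j)//=.
rewrite big_seq big1 ?addr0 ?subrr ?(norm_zero hN)// => i.
by rewrite !inE => /andP[/h].
Qed.

End FamilySums.

Lemma has_sum_lipschitz (R : realType) (V W : PreTopologicalZmodule.type)
    (N : V -> R) (N' : W -> R) (J : countType) (x : J -> V) (l : V)
    (phi : V -> W) (C : R) :
  complete_norm N -> complete_norm N' ->
  {morph phi : a b / a + b} -> phi 0 = 0 -> (forall a, N' (phi a) <= C * N a) ->
  has_sum x l -> has_sum (phi \o x) (phi l).
Proof.
move=> hN hN' phiD phi0 hC /(has_sumP hN) h; apply/(has_sumP hN') => e e0.
(* [C] may vanish or be negative, whereas [|C| + 1] is positive and still dominates it. *)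
have e1 : 0 < e / (`|C| + 1) by rewrite divr_gt0// ltr_wpDl.
have [G hG] := h _ e1; exists G => F /hG.
rewrite ltr_pdivlMr ?ltr_wpDl// => hF.
rewrite -(big_morph phi phiD phi0).
have -> a b : phi a - phi b = phi (a - b).
  by apply/eqP; rewrite subr_eq -phiD subrK.
apply: le_lt_trans hF; rewrite (le_trans (hC _))// mulrC.
rewrite ler_wpM2l ?(norm_ge0 hN)// (le_trans (ler_norm _))// lerDl//.
Qed.

(** * C*-algebras *)

(** Products in [A] do not commute; these instances let [ncring] prove identities in any ring. *)
#[local] Instance ncring_ops (A : pzRingType) : @Ncring.Ring_ops A 0 1
  (@GRing.add A) (@GRing.mul A) (fun x y => x - y) (@GRing.opp A) (@eq A) := {}.
#[local] Instance ncring_ring (A : pzRingType) :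
  @Ncring.Ring _ _ _ _ _ _ _ _ (ncring_ops A).
Proof.
split; try exact _.
- exact: (@add0r A).
- exact: (@addrC A).
- exact: (@addrA A).
- exact: (@mul1r A).
- exact: (@mulr1 A).
- exact: (@mulrA A).
- exact: (@mulrDl A).
- by move=> x y z; exact: (@mulrDr A).
- by [].
- exact: (@subrr A).
Qed.
Local Ltac ncring := Ncring_tac.non_commutative_ring.

(** * Real scalars, the involution and invertibility *)

Section CStarTheory.
Context (R : realType) (A : cstarAlgType R).
Implicit Types (a b c d p q : A) (r t : R).
Local Notation N := (@cnorm R A).

(** Real scalars are treated as central self-adjoint elements, so that computations mixing both take
    place in one ring. *)
Definition scal r : A := (r%:C)%:A.

Lemma scalD r t : scal (r + t) = scal r + scal t.
Proof. by rewrite /scal rmorphD scalerDl. Qed.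
Lemma scalN r : scal (- r) = - scal r.
Proof. by rewrite /scal rmorphN scaleNr. Qed.
Lemma scalB r t : scal (r - t) = scal r - scal t.
Proof. by rewrite scalD scalN. Qed.
Lemma scalM r t : scal (r * t) = scal r * scal t.
Proof. by rewrite /scal rmorphM -scalerAl mul1r scalerA. Qed.
Lemma scal0 : scal 0 = 0.
Proof. by rewrite /scal rmorph0 scale0r. Qed.
Lemma scal1 : scal 1 = 1.
Proof. by rewrite /scal rmorph1 scale1r. Qed.
Lemma scalC r a : a * scal r = scal r * a.
Proof. by rewrite /scal -scalerAl -scalerAr mulr1 mul1r. Qed.
Lemma scal_mulE r a : scal r * a = r%:C *: a.
Proof. by rewrite /scal -scalerAl mul1r. Qed.

Lemma normc_real r : Normc.normc r%:C = `|r|.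
Proof. by rewrite /= expr0n/= addr0 sqrtr_sqr. Qed.

Lemma cnorm_scal r a : N (scal r * a) = `|r| * N a.
Proof. by rewrite scal_mulE cnormZ normc_real. Qed.

Lemma cnorm0 : N 0 = 0.
Proof. by rewrite -(scale0r (0 : A)) cnormZ Normc.normc0 mul0r. Qed.

Lemma cnormN a : N (- a) = N a.
Proof.
have -> : - a = scal (-1) * a by rewrite scalN scal1 mulN1r.
by rewrite cnorm_scal normrN1 mul1r.
Qed.

Lemma cnorm_complete : complete_norm N.
Proof.
split.
- exact: cnorm0.
- exact: cnorm_eq0.
- exact: cnormD.
- exact: cnormN.
- move=> F l FF; split=> [/cvg_entourageP h e e0|h].
    have E : entourage [set ab : A * A | N (ab.1 - ab.2) < e].
      by rewrite cnorm_entourage; exists e.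
    by have := h _ E; apply: filterS => x /=; rewrite -cnormN opprB.
  apply/cvg_entourageP => E; rewrite cnorm_entourage => -[e /= e0 hE].
  by have := h e e0; apply: filterS => x /= hx; apply: hE; rewrite /= -cnormN opprB.
- move=> F PF h; apply: cstar_complete => E; rewrite /= cnorm_entourage.
  move=> -[e /= e0 hE].
  have [x Fx] := h (e / 2) (divr_gt0 e0 (ltr0n _ 2)).
  exists ([set y | N (y - x) < e / 2], [set y | N (y - x) < e / 2]) => //=.
  move=> [y z] /= [yx zx]; apply: hE => /=.
  have : N (y - z) <= N (y - x) + N (x - z).
    by rewrite -[y - z](subrKA x) cnormD.
  rewrite -(cnormN (x - z)) opprB; lra.
Qed.

Lemma cnorm_ge0 a : 0 <= N a.
Proof. exact: (norm_ge0 cnorm_complete). Qed.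

Lemma cnormB a b : N (a - b) <= N a + N b.
Proof. by rewrite -(cnormN b) cnormD. Qed.

Lemma star_scal r : star (scal r) = scal r.
Proof.
have star1 : star 1 = 1 :> A.
  by rewrite -[LHS]mulr1 -[X in _ * X](starK 1) -starM mulr1 starK.
by rewrite /scal starZ star1 conj_Creal// complex_real.
Qed.

Lemma star1 : star 1 = 1 :> A.
Proof. by rewrite -scal1 star_scal. Qed.

Lemma star0 : star 0 = 0 :> A.
Proof. by rewrite -scal0 star_scal. Qed.

Lemma starN a : star (- a) = - star a.
Proof.
have mN1 b : - b = scal (-1) * b by rewrite scalN scal1 mulN1r.
by rewrite mN1 starM star_scal scalC -mN1.
Qed.

Lemma starB a b : star (a - b) = star a - star b.
Proof. by rewrite starD starN. Qed.

Lemma star_scalM r a : star (scal r * a) = scal r * star a.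
Proof. by rewrite starM star_scal scalC. Qed.

Lemma cnorm_starE a : N (star a) = N a.
Proof.
suff h b : N b <= N (star b) by apply/eqP; rewrite eq_le h -{2}[a]starK h.
have := cnormM (star b) b; rewrite cnorm_star.
have := cnorm_ge0 b; rewrite le_eqVlt => /predU1P[<- _|b0]; first exact: cnorm_ge0.
by rewrite expr2 ler_pM2r.
Qed.

Lemma cnorm_mul_star a : N (a * star a) = N a ^+ 2.
Proof. by rewrite -{1}[a]starK cnorm_star cnorm_starE. Qed.

Lemma cnorm1_le1 : N 1 <= 1.
Proof.
have := cnorm_star (1 : A); rewrite star1 mulr1.
have := cnorm_ge0 1; nra.
Qed.

Lemma cnorm_scal_le r : N (scal r) <= `|r|.
Proof.
by rewrite -[scal r]mulr1 cnorm_scal ler_piMr// cnorm1_le1.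
Qed.

Lemma invertible_lr a b c : a * b = 1 -> c * a = 1 -> invertible a.
Proof.
move=> ab ca; exists b; split=> //.
by have -> : b = c by rewrite -[b]mul1r -ca -mulrA ab mulr1.
Qed.

Lemma invertible_mull a b : a * b = b * a -> invertible (a * b) -> invertible a.
Proof.
move=> ab [c [h1 h2]]; apply: (@invertible_lr _ (b * c) (c * b)).
  by rewrite mulrA.
by rewrite -mulrA -ab.
Qed.

Lemma invertibleM a b : invertible a -> invertible b -> invertible (a * b).
Proof.
move=> [a' [h1 h2]] [b' [h3 h4]]; exists (b' * a'); split.
  by rewrite -mulrA [b * _]mulrA h3 mul1r.
by rewrite -mulrA [a' * _]mulrA h2 mul1r.
Qed.

Lemma invertible_scal r : r != 0 -> invertible (scal r).
Proof. by move=> r0; exists (scal r^-1); rewrite -!scalM mulfV ?mulVf// scal1. Qed.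

(** If [c] inverts [scal r + a * b], then [r^-1 (1 - b c a)] inverts [scal r + b * a]. This is the
    argument by which [a * b] and [b * a] share their nonzero spectrum. *)
Lemma invertible_add_swap r a b : r != 0 ->
  invertible (scal r + a * b) -> invertible (scal r + b * a).
Proof.
move=> r0 [c [h1 h2]].
have e1 : (scal r + b * a) * (1 - b * c * a) = scal r.
  have -> : (scal r + b * a) * (1 - b * c * a) =
      scal r + b * a - scal r * b * c * a - b * (a * b * c) * a by ncring.
  have -> : a * b * c = 1 - scal r * c by rewrite -h1; ncring.
  have -> : b * (1 - scal r * c) * a = b * a - (b * scal r) * c * a by ncring.
  rewrite scalC; ncring.
have e2 : (1 - b * c * a) * (scal r + b * a) = scal r.
  have -> : (1 - b * c * a) * (scal r + b * a) =
      scal r + b * a - b * c * (a * scal r) - b * (c * (a * b)) * a by ncring.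
  have -> : c * (a * b) = 1 - c * scal r by rewrite -h2; ncring.
  rewrite scalC; ncring.
apply: (@invertible_lr _ ((1 - b * c * a) * scal r^-1) (scal r^-1 * (1 - b * c * a))).
  by rewrite mulrA e1 -scalM mulfV ?scal1.
by rewrite -mulrA e2 -scalM mulVf ?scal1.
Qed.

Lemma inverse_comm a b c : a * b = 1 -> b * a = 1 -> c * a = a * c ->
  c * b = b * c.
Proof.
by move=> ab ba ca; rewrite -[c * b]mul1r -ba -mulrA [a * _]mulrA -ca -mulrA ab mulr1.
Qed.

Lemma inverse_star a b : star a = a -> a * b = 1 -> b * a = 1 -> star b = b.
Proof.
move=> sa ab ba.
have h : star b * a = 1 by rewrite -{1}sa -starM ab star1.
by rewrite -[star b]mulr1 -ab mulrA h mul1r.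
Qed.

(** The maps [x |-> 1 + a * x] and [x |-> 1 + x * a] are contractions; their fixed points are a
    right and a left inverse of [1 - a]. *)
Lemma neumann a : N a < 1 -> invertible (1 - a).
Proof.
move=> a1.
have Na := cnorm_ge0 a.
have r01 : 0 <= N a < 1 by rewrite Na.
have [//| |//|bl _ hl] := @contraction_fixpoint _ _ _ cnorm_complete
  (fun=> True) (fun x => 1 + a * x) 0 (N a) r01 I.
- by move=> x y _ _; rewrite opprD addrACA subrr add0r -mulrBr cnormM.
have [//| |//|br _ hr] := @contraction_fixpoint _ _ _ cnorm_complete
  (fun=> True) (fun x => 1 + x * a) 0 (N a) r01 I.
- by move=> x y _ _; rewrite opprD addrACA subrr add0r -mulrBl mulrC cnormM.
apply: (@invertible_lr _ bl br).
- by rewrite mulrBl mul1r -{1}hl addrK.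
- by rewrite mulrBr mulr1 -{1}hr addrK.
Qed.

End CStarTheory.

(** * Square roots and positivity *)

Section Positivity.
Context (R : realType) (A : cstarAlgType R).
Implicit Types (a b c d p q : A) (r t : R).
Local Notation N := (@cnorm R A).
Local Notation scal := (@scal R A).

(** Being self-adjoint, or commuting with a given element, is the vanishing of a bounded additive
    map, and so passes to limits. *)
Lemma seq_lim_stable (phi : A -> A) (C : R) (u : nat -> A) (l : A) :
  (forall a b, phi (a - b) = phi a - phi b) -> (forall a, N (phi a) <= C * N a) ->
  (forall n, phi (u n) = 0) -> seq_lim N u l -> phi l = 0.
Proof.
move=> phiB hC phiu ul; apply: (norm_sub_eq (@cnorm_complete R A)) => e e0.
have e1 : 0 < e / (`|C| + 1) by rewrite divr_gt0// ltr_wpDl.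
have [n hn] := ul _ e1; have := hn n (leqnn n).
rewrite ltr_pdivlMr ?ltr_wpDl// => {}hn.
rewrite subr0 -(subr0 (phi l)) -(phiu n) -phiB (le_trans (hC _))//.
rewrite (le_trans _ (ltW hn))// (norm_sub (@cnorm_complete R A)) mulrC.
rewrite ler_wpM2l ?cnorm_ge0// (le_trans (ler_norm _))// lerDl//.
Qed.

Lemma scal_half : scal 2^-1 + scal 2^-1 = 1.
Proof. by rewrite -scalD -(scal1 A); congr (scal _); lra. Qed.

(* The root is [1 - y] for the fixed point [y] of [y |-> (1 - p + y ^ 2) / 2]. *)
Lemma sqrt_near1 p : star p = p -> N (1 - p) < 1 ->
  exists s, [/\ star s = s, s * s = p, invertible s
    & forall z, z * p = p * z -> z * s = s * z].
Proof.
move=> sp; set x := 1 - p; set r := N x => p1.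
have r0 : 0 <= r := cnorm_ge0 _.
have sx : star x = x by rewrite /x starB star1 sp.
pose h := scal 2^-1.
have n2 a : N (h * a) = N a / 2 by rewrite cnorm_scal ger0_norm ?invr_ge0// mulrC.
(* Elements of [Q] commute with the commutant of [x], hence with one another. So [f y - f y']
   factors as half of [(y - y') * (y + y')], and [f] contracts by [r] on [Q]. *)
pose Q y := [/\ N y <= r, star y = y & forall z, z * x = x * z -> z * y = y * z].
pose f y := h * (x + y * y).
have r01 : 0 <= r < 1 by rewrite r0.
have [| | | |y [Ny sy cy] hy] :=
  @contraction_fixpoint _ _ _ (@cnorm_complete R A) Q f 0 r r01.
- split; rewrite ?cnorm0 ?star0// => z _; ncring.
- move=> y [Ny sy cy]; split.
  + rewrite n2; have := cnormD x (y * y); have := cnormM y y; have := cnorm_ge0 y.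
    rewrite -/r; nra.
  + by rewrite star_scalM starD starM sx sy.
  + move=> z zx; rewrite /f mulrA scalC -!mulrA; congr (_ * _).
    have zy := cy z zx.
    by rewrite mulrDr mulrDl zx mulrA zy -!mulrA zy.
- move=> y y' [Ny sy cy] [Ny' sy' cy'].
  have yx : y * x = x * y by rewrite cy.
  have yy : y * y' = y' * y by rewrite cy'.
  have -> : f y - f y' = h * ((y - y') * (y + y')).
    rewrite /f -mulrBr; congr (_ * _).
    have -> : (y - y') * (y + y') = y * y + y * y' - y' * y - y' * y' by ncring.
    rewrite yy; ncring.
  rewrite n2; have := cnormM (y - y') (y + y'); have := cnormD y y'.
  have := cnorm_ge0 (y - y'); nra.
- move=> u l Qu ul; split.
  + apply/ler_addgt0Pr => e e0; have [n hn] := ul e e0.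
    have := hn n (leqnn n); have [Nu _ _] := Qu n.
    have := norm_subD (@cnorm_complete R A) l (u n) 0; rewrite !subr0.
    rewrite (norm_sub (@cnorm_complete R A)); lra.
  + apply/eqP; rewrite -subr_eq0; apply/eqP.
    apply: (@seq_lim_stable (fun a => star a - a) 2 u l _ _ _ ul).
    * by move=> a b; rewrite starB; ncring.
    * by move=> a; have := cnormB (star a) a; rewrite cnorm_starE; lra.
    * by move=> n; have [_ -> _] := Qu n; rewrite subrr.
  + move=> z zx; apply/eqP; rewrite -subr_eq0; apply/eqP.
    apply: (@seq_lim_stable (fun a => z * a - a * z) (2 * N z) u l _ _ _ ul).
    * by move=> a b; ncring.
    * move=> a; have := cnormB (z * a) (a * z); have := cnormM z a.
      have := cnormM a z; lra.
    * by move=> n; have [_ _ /(_ z zx) ->] := Qu n; rewrite subrr.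
have yy : y * y = y + y - x.
  rewrite -{3 4}hy /f -mulrDl scal_half mul1r; ncring.
exists (1 - y); split.
- by rewrite starB star1 sy.
- have -> : (1 - y) * (1 - y) = 1 - y - y + y * y by ncring.
  rewrite yy /x; ncring.
- apply: neumann; lra.
- move=> z zp; rewrite mulrBr mulrBl mulr1 mul1r cy// /x.
  by rewrite mulrBr mulrBl mulr1 mul1r zp.
Qed.

(* For a self-adjoint [p] this says that the spectrum lies in [0, 2 t]. *)
Definition pos p := star p = p /\ exists2 t, 0 <= t & N (scal t - p) <= t.

Lemma pos_star p : pos p -> star p = p. Proof. by case. Qed.

Lemma pos_add p q : pos p -> pos q -> pos (p + q).
Proof.
move=> [sp [t t0 ht]] [sq [r r0 hr]]; split; first by rewrite starD sp sq.
exists (t + r); first exact: addr_ge0.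
by rewrite scalD opprD addrACA (le_trans (cnormD _ _))// lerD.
Qed.

Lemma pos_scalM r p : 0 <= r -> pos p -> pos (scal r * p).
Proof.
move=> r0 [sp [t t0 ht]]; split; first by rewrite star_scalM sp.
exists (r * t); first exact: mulr_ge0.
by rewrite scalM -mulrBr cnorm_scal ger0_norm// ler_wpM2l.
Qed.

Lemma pos_scal_sub r b : star b = b -> N b <= r -> pos (scal r - b).
Proof.
move=> sb br; split; first by rewrite starB star_scal sb.
exists r; first exact: le_trans (cnorm_ge0 _) br.
by rewrite opprB addrCA subrr addr0.
Qed.

Lemma pos_scal_add r b : star b = b -> N b <= r -> pos (scal r + b).
Proof.
by move=> sb br; rewrite -[b]opprK; apply: pos_scal_sub; rewrite ?starN ?sb// cnormN.
Qed.

Lemma pos_scal r : 0 <= r -> pos (scal r).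
Proof.
by move=> r0; rewrite -(addr0 (scal r)); apply: pos_scal_add; rewrite ?star0// cnorm0.
Qed.

Lemma pos_zero : pos 0.
Proof. by rewrite -(scal0 A); apply: pos_scal. Qed.

Lemma pos_sum (J : Type) (s : seq J) (x : J -> A) :
  (forall j, pos (x j)) -> pos (\sum_(j <- s) x j).
Proof. by move=> h; apply: big_ind => //; [exact: pos_zero|exact: pos_add]. Qed.

(** Divided by [t + e], the element [p + scal e] lies within [t / (t + e) < 1] of the unit, so
    [sqrt_near1] applies. The shift by [e] makes this bound strict. *)
Lemma pos_sqrt p e : pos p -> 0 < e -> exists s,
  [/\ star s = s, s * s = p + scal e, invertible s
    & forall z, z * p = p * z -> z * s = s * z].
Proof.
move=> [sp [t t0 ht]] e0.
have te0 : 0 < t + e by rewrite ltr_wpDl.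
have te1 : (t + e)^-1 * (t + e) = 1 by rewrite mulVf ?gt_eqF.
have [||s [ss s2 si sc]] := @sqrt_near1 (scal (t + e)^-1 * (p + scal e)).
- by rewrite star_scalM starD star_scal sp.
- have -> : 1 - scal (t + e)^-1 * (p + scal e) = scal (t + e)^-1 * (scal t - p).
    rewrite -(scal1 A) -te1 scalM -mulrBr; congr (_ * _).
    rewrite scalD; ncring.
  rewrite cnorm_scal ger0_norm ?invr_ge0 ?ltW// mulrC ltr_pdivrMr// mul1r.
  by rewrite (le_lt_trans ht)// ltrDl.
have rt0 : 0 < Num.sqrt (t + e) by rewrite sqrtr_gt0.
exists (scal (Num.sqrt (t + e)) * s); split.
- by rewrite star_scalM ss.
- rewrite mulrA -[_ * s * _]mulrA scalC mulrA -scalM -mulrA s2.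
  by rewrite -expr2 sqr_sqrtr ?ltW// mulrA -scalM mulrC te1 scal1 mul1r.
- by apply: invertibleM => //; apply: invertible_scal; rewrite gt_eqF.
- move=> z zp; rewrite mulrA scalC -!mulrA; congr (_ * _); apply: sc.
  rewrite mulrA scalC -!mulrA; congr (_ * _).
  by rewrite mulrDr mulrDl zp scalC.
Qed.

Definition imag : A := 'i%C *: 1.

Lemma imagC a : a * imag = imag * a.
Proof. by rewrite /imag -scalerAl -scalerAr mulr1 mul1r. Qed.

Lemma imag2 : imag * imag = -1.
Proof. by rewrite /imag -scalerAl mul1r scalerA -expr2 sqr_i scaleN1r. Qed.

Lemma star_imag : star imag = - imag.
Proof.
rewrite /imag starZ star1.
have -> : ('i : R[i])^*%R = - 'i by rewrite /= /Num.conj/=; congr Complex; rewrite ?oppr0.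
by rewrite scaleNr.
Qed.

Lemma cnorm_imag a : N (imag * a) = N a.
Proof.
rewrite /imag -scalerAl mul1r cnormZ /= expr0n/= add0r expr1n sqrtr1 mul1r//.
Qed.

(** The element [w = x + i y] satisfies [star w * w = scal (t ^+ 2)], so its norm is at most [t] by
    the C*-identity; [x] and [y] are its real and imaginary parts. *)
Lemma cartesian_norm x y : star x = x -> star y = y -> x * y = y * x ->
  forall t, 0 <= t -> x * x + y * y = scal (t ^+ 2) -> N x <= t /\ N y <= t.
Proof.
move=> sx sy xy t t0 e; set w := x + imag * y.
have sw : star w = x - imag * y.
  by rewrite /w starD starM star_imag sx sy mulrN imagC.
have Nw : N w <= t.
  rewrite -(@ler_pXn2r _ 2)// ?nnegrE ?cnorm_ge0// -cnorm_star sw.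
  have -> : (x - imag * y) * w = scal (t ^+ 2).
    have -> : (x - imag * y) * w =
        x * x + x * imag * y - imag * (y * x) - imag * (y * imag) * y.
      by rewrite /w; ncring.
    rewrite !imagC -xy -e.
    have -> : imag * (imag * y) * y = (imag * imag) * y * y by ncring.
    rewrite imag2; ncring.
  by rewrite (le_trans (cnorm_scal_le _ _))// ger0_norm ?exprn_ge0.
have Nsw : N (star w) <= t by rewrite cnorm_starE.
have half z z' : z + z = z' -> N z' <= t + t -> N z <= t.
  move=> <-; have -> : z + z = scal 2 * z.
    by rewrite (_ : 2 = 1 + 1)// scalD scal1 mulrDl mul1r.
  by rewrite cnorm_scal ger0_norm//; lra.
split.
- apply: (half _ (w + star w)); first by rewrite sw /w; ncring.
  by rewrite (le_trans (cnormD _ _))// lerD.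
- rewrite -(cnorm_imag y); apply: (half _ (w - star w)); first by rewrite sw /w; ncring.
  by rewrite (le_trans (cnormB _ _))// lerD.
Qed.

(** Let [s] be the root of [t - b ^ 2] for [t = N b ^+ 2 + 1]. Then [b ^ 2 + s ^ 2 = t], so
    [cartesian_norm] bounds [s ^ 2 = t - b ^ 2] by [t], as [pos] demands. *)
Lemma pos_sqr b : star b = b -> pos (b * b).
Proof.
move=> sb; split; first by rewrite starM sb.
have Nb2 : N (b * b) <= N b ^+ 2 by rewrite expr2 cnormM.
have [|s [ss s2 _ sc]] := pos_sqrt (@pos_scal_sub (N b ^+ 2) (b * b) _ Nb2) ltr01.
  by rewrite starM sb.
have bs : b * s = s * b.
  by apply: sc; rewrite mulrBl mulrBr scalC mulrA.
have t0 : 0 <= N b ^+ 2 + 1 by rewrite addr_ge0 ?exprn_ge0 ?cnorm_ge0.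
have [] := cartesian_norm sb ss bs (sqrtr_ge0 (N b ^+ 2 + 1)).
  rewrite sqr_sqrtr// s2 scalD; ncring.
move=> _ Ns; exists (N b ^+ 2 + 1) => //.
have -> : scal (N b ^+ 2 + 1) - b * b = s * s by rewrite s2 scalD; ncring.
rewrite (le_trans (cnormM _ _))// -expr2 -[leRHS]sqr_sqrtr//.
by rewrite ler_pXn2r// ?nnegrE ?cnorm_ge0 ?sqrtr_ge0.
Qed.

(** The roots [s] of [t - a + e] and [v] of [t + a + e] commute with [a] and with each other, and
    [a ^ 2 + (s v) ^ 2 = (t + e) ^ 2]; [cartesian_norm] then bounds [a] by [t + e]. *)
Lemma pos_norm_le a t : 0 <= t -> pos (scal t - a) -> pos (scal t + a) -> N a <= t.
Proof.
move=> t0 pa pa'; apply/ler_addgt0Pr => e e0.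
have sa : star a = a.
  have /pos_star := pa'; rewrite starD star_scal; exact: addrI.
have [s [ss s2 _ sc]] := pos_sqrt pa e0.
have [v [sv v2 _ vc]] := pos_sqrt pa' e0.
have as_ : a * s = s * a by apply: sc; rewrite mulrBl mulrBr scalC.
have av : a * v = v * a by apply: vc; rewrite mulrDl mulrDr scalC.
have svc : s * v = v * s by apply: vc; rewrite mulrDl mulrDr scalC as_.
have [] // := @cartesian_norm a (s * v) sa _ _ (t + e).
- by rewrite starM ss sv svc.
- by rewrite mulrA as_ -mulrA av mulrA.
- by rewrite addr_ge0// ltW.
have -> : s * v * (s * v) = (s * s) * (v * v).
  by rewrite -!mulrA; congr (_ * _); rewrite !mulrA svc.
rewrite s2 v2 expr2 scalM scalD.
have -> : (scal t - a + scal e) * (scal t + a + scal e) =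
   (scal t + scal e) * (scal t + scal e) - a * a
   + (scal t * a - a * scal t) + (scal e * a - a * scal e) by ncring.
rewrite !scalC !subrr; ncring.
Qed.

(** Any bound on the norm can serve as the witness in [pos]. A witness chosen uniformly is what
    makes positivity a closed condition. *)
Lemma pos_norm_scal_sub p r : pos p -> N p <= r -> N (scal r - p) <= r.
Proof.
move=> pp pr; have r0 := le_trans (cnorm_ge0 p) pr.
apply: pos_norm_le => //; first by rewrite opprB addrCA subrr addr0.
rewrite addrA -scalD; apply: pos_scal_sub; first exact: pos_star.
by rewrite (le_trans pr)// lerDl.
Qed.

Lemma pos_closed p : star p = p -> (forall e, 0 < e -> pos (p + scal e)) -> pos p.
Proof.
move=> sp h; split=> //; exists (N p); first exact: cnorm_ge0.
apply/ler_addgt0Pr => e e0.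
have := @pos_norm_scal_sub _ (N p + e) (h e e0).
have -> : scal (N p + e) - (p + scal e) = scal (N p) - p by rewrite scalD; ncring.
apply; rewrite (le_trans (cnormD _ _))// lerD2l (le_trans (cnorm_scal_le _ _))//.
by rewrite gtr0_norm.
Qed.

(** With [s] and [v] the roots of [p + e] and [q + e], the square of [s * v] is positive and differs
    from [p * q] by [e (p + q + e)]. *)
Lemma pos_mul_comm p q : pos p -> pos q -> p * q = q * p -> pos (p * q).
Proof.
move=> pp pq pqC.
apply: pos_closed => [|d d0]; first by rewrite starM !pos_star.
set M := N p + N q + 1.
have M1 : 1 <= M by rewrite lerDr addr_ge0 ?cnorm_ge0.
have M0 : 0 < M := lt_le_trans ltr01 M1.
(* This choice bounds the norm of the error [e (p + q + e)] by [d]. *)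
set e := Num.min 1 (d / M).
have e0 : 0 < e by rewrite lt_min ltr01 divr_gt0.
have [e1 eM] : e <= 1 /\ e * M <= d.
  by split; [rewrite ge_min lexx | rewrite -ler_pdivlMr// ge_min lexx orbT].
have [s [ss s2 _ sc]] := pos_sqrt pp e0.
have [v [sv v2 _ vc]] := pos_sqrt pq e0.
have sv_ : s * v = v * s by apply: vc; rewrite -sc// pqC.
have -> : p * q + scal d = (s * v) * (s * v) +
   (scal d - scal e * (p + q + scal e)).
  have -> : s * v * (s * v) = (s * s) * (v * v).
    by rewrite -!mulrA; congr (_ * _); rewrite !mulrA sv_.
  rewrite s2 v2.
  have -> : (p + scal e) * (q + scal e) =
    p * q + p * scal e + scal e * (q + scal e) by ncring.
  rewrite scalC; ncring.
apply: pos_add; first by apply: pos_sqr; rewrite starM ss sv sv_.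
apply: pos_scal_sub; first by rewrite star_scalM !starD (pos_star pp) (pos_star pq) star_scal.
rewrite cnorm_scal gtr0_norm//; apply: le_trans eM; rewrite ler_pM2l//.
rewrite (le_trans (cnormD _ _))// lerD ?cnormD//.
by rewrite (le_trans (cnorm_scal_le _ _))// gtr0_norm.
Qed.

(** Write [h - t = h (1 - t h^-1)]: the factors commute, and the second is positive once [t] times
    the norm of [h^-1] is at most 1. *)
Lemma pos_inv_sub h : pos h -> invertible h ->
  exists2 r, 0 < r & forall t, 0 <= t <= r -> pos (h - scal t).
Proof.
move=> ph [g [hg gh]]; have sh := pos_star ph.
have sg := inverse_star sh hg gh.
have Ng : 0 < N g + 1 by rewrite ltr_wpDl ?cnorm_ge0.
exists (N g + 1)^-1; first by rewrite invr_gt0.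
move=> d' /andP[d0 d1].
have -> : h - scal d' = h * (scal 1 - scal d' * g).
  by rewrite mulrBr scal1 mulr1 mulrA scalC -mulrA hg mulr1.
apply: pos_mul_comm => //.
  apply: pos_scal_sub; first by rewrite star_scalM sg.
  rewrite cnorm_scal ger0_norm//.
  rewrite (le_trans (ler_wpM2r (cnorm_ge0 _) d1))// ler_pdivrMl// mulr1 lerDl//.
by rewrite mulrBr mulrBl scal1 mulr1 mul1r mulrA scalC -!mulrA hg gh.
Qed.

(** Let [m] be the infimum of the [r >= 0] for which [a + scal r] is positive. It is attained
    because positivity is closed; if [m > 0], invertibility at [m] and [pos_inv_sub] would allow a
    smaller shift. *)
Lemma invertible_pos a : star a = a ->
  (forall r, 0 < r -> invertible (a + scal r)) -> pos a.
Proof.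
move=> sa ia.
set S := [set r | 0 <= r /\ pos (a + scal r)] : set R.
have SN : S (N a).
  by split; [exact: cnorm_ge0 | rewrite addrC; apply: pos_scal_add].
have hS : has_inf S by split; [exists (N a) | exists 0 => r []].
set m := inf S.
have m0 : 0 <= m by apply: lb_le_inf; [exists (N a) | move=> r []].
have pm : pos (a + scal m).
  apply: pos_closed => [|e e0]; first by rewrite starD star_scal sa.
  have [r [r0 pr] rm] := inf_adherent e0 hS.
  have -> : a + scal m + scal e = (a + scal r) + scal (m + e - r).
    by rewrite scalB scalD; ncring.
  by apply: pos_add => //; apply: pos_scal; rewrite subr_ge0 ltW.
move: m0; rewrite le_eqVlt => /predU1P[m0|m0].
  by move: pm; rewrite -m0 scal0 addr0.
have [d d0 hd] := pos_inv_sub pm (ia m m0).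
set d' := Num.min d m.
have d'0 : 0 < d' by rewrite lt_min d0.
have Sd : S (m - d').
  split; first by rewrite subr_ge0 ge_min lexx orbT.
  have -> : a + scal (m - d') = a + scal m - scal d' by rewrite scalB; ncring.
  by apply: hd; rewrite ltW//= ge_min lexx.
have := ge_inf hS.2 Sd; rewrite -/m; lra.
Qed.

Lemma pos_invertible p e : pos p -> 0 < e -> invertible (p + scal e).
Proof.
by move=> pp e0; have [s [_ <- si _]] := pos_sqrt pp e0; exact: invertibleM.
Qed.

(** For [b = a - Re z] and [y = Im z] nonzero, [b - i y] is a factor of [b ^ 2 + y ^ 2], which is
    invertible; the factors commute. *)
Lemma real_spectrum a (z : R[i]) : star a = a -> spectrum a z -> complex.Im z = 0.
Proof.
move=> sa; apply: contra_notP => /eqP z0.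
set b := a - scal (complex.Re z); set y := complex.Im z in z0.
have sb : star b = b by rewrite starB star_scal sa.
have -> : a - z%:A = b - imag * scal y.
  rewrite /b [in LHS](complexE z) scalerDl /scal /imag -scalerAl mul1r scalerA.
  ncring.
set w := imag * scal y.
have bw : b * w = w * b by rewrite /w mulrA imagC -!mulrA scalC.
have ww : w * w = - scal (y ^+ 2).
  have -> : w * w = imag * (scal y * imag) * scal y by rewrite /w; ncring.
  rewrite imagC expr2 scalM.
  have -> : imag * (imag * scal y) * scal y = (imag * imag) * (scal y * scal y).
    by ncring.
  by rewrite imag2 mulN1r.
clearbody w b.
have bwbw : (b - w) * (b + w) = b * b + scal (y ^+ 2).
  by rewrite mulrBl !mulrDr ww bw; ncring.
apply: (@invertible_mull _ _ _ (b + w)).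
  by rewrite mulrBl mulrDl !mulrBr !mulrDr bw; ncring.
rewrite bwbw.
apply: pos_invertible; first exact: pos_sqr.
by rewrite lt_neqAle eq_sym sqrf_eq0 z0 sqr_ge0.
Qed.

Lemma cstar_nnegP a : cstar_nneg a <-> pos a.
Proof.
split=> [[sa h]|pa].
  apply: invertible_pos => // r r0; apply: contrapT => ni.
  have : spectrum a (- r%:C) by rewrite /spectrum/= scaleNr opprK.
  by move=> /h /=; rewrite oppr_ge0 lecE/= => /andP[_]; rewrite leNgt r0.
have sa := pos_star pa; split=> // z hz.
have Iz := real_spectrum sa hz.
rewrite /= lecE Iz eqxx/= leNgt; apply/negP => Rz; apply: hz.
have -> : a - z%:A = a + scal (- complex.Re z).
  by rewrite scalN {1}(complexE z) Iz mulr0 addr0.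
by apply: pos_invertible; rewrite // oppr_gt0.
Qed.
End Positivity.

(** * Positivity of [a * star a] and its consequences *)

Section PositiveProducts.
Context (R : realType) (A : cstarAlgType R).
Implicit Types (a b c d p q : A) (r t : R).
Local Notation N := (@cnorm R A).
Local Notation scal := (@scal R A).

(** Up to sign, [x] and [y] are the real and imaginary parts of [a], and the sum equals
    [2 (x ^ 2 + y ^ 2)]. *)
Lemma pos_star_sum a : pos (star a * a + a * star a).
Proof.
pose h := scal 2^-1.
pose x := h * (a + star a); pose y := imag A * (h * (a - star a)).
have sx : star x = x by rewrite /x star_scalM starD starK addrC.
have sy : star y = y.
  rewrite /y starM star_imag star_scalM starB starK mulrN imagC -mulrN.
  by congr (_ * _); rewrite -mulrN opprB.
have -> : star a * a + a * star a = scal 2 * (x * x + y * y).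
  have hh u v : h * u * (h * v) = scal 4^-1 * (u * v).
    rewrite mulrA -[h * u * h]mulrA scalC !mulrA -scalM.
    by congr (scal _ * _ * _); field.
  have -> : y * y = - (h * (a - star a) * (h * (a - star a))).
    have -> : y * y = imag A * (h * (a - star a) * imag A) * (h * (a - star a)).
      by rewrite /y; ncring.
    rewrite imagC; have -> u v : imag A * (imag A * u) * v = (imag A * imag A) * (u * v).
      by ncring.
    by rewrite imag2 mulN1r.
  rewrite /x !hh -mulrBr mulrA -scalM.
  have -> : (a + star a) * (a + star a) - (a - star a) * (a - star a) =
    (1 + 1) * (star a * a + a * star a) by ncring.
  rewrite -(scal1 A) -scalD mulrA -scalM (_ : 2 * 4^-1 * (1 + 1) = 1 :> R) ?scal1 ?mul1r//.
  by field.
by apply: pos_scalM => //; apply: pos_add; apply: pos_sqr.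
Qed.

(* One step to the left along the negative axis: for [g = (a a* + r)^-1] the
   product [(g a)(g a)*] is at most [1 / (4 r)], hence [(g a)* (g a)], and
   with it [(g a)(g a)*], is at least [- 1 / (4 r)]. *)
Lemma mulstar_invertible_step a r t : 0 < r -> r / 2 <= t <= r ->
  invertible (a * star a + scal r) -> invertible (a * star a + scal t).
Proof.
move=> r0 /andP[rt tr] [g [cg gc]].
set c := a * star a in cg gc *.
have sc : star c = c by rewrite /c starM starK.
have scr : star (c + scal r) = c + scal r by rewrite starD sc star_scal.
have sg := inverse_star scr cg gc.
have gC : c * g = g * c.
  by apply: (inverse_comm cg gc); rewrite mulrDl mulrDr scalC.
move: tr; rewrite le_eqVlt => /predU1P[->|tr]; first by exists g.
have [t0 tau0] : 0 < t /\ 0 < r - t by lra.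
pose w := g * (c - scal r).
have sw : star w = w.
  by rewrite /w starM starB star_scal sg sc mulrBl mulrBr gC scalC.
pose d := g * a.
have dd : d * star d = g * c * g by rewrite /d starM sg /c; ncring.
(* With this [k], [c = - t] is a root of [k (c + r) ^ 2 + c], whence the factor [c + scal t] below.
   The bound [k0] is the maximum of [c / (c + r) ^ 2] over scalars [c >= 0], and [r / 2 <= t < r]
   places [k] above it. *)
pose k := t / (r - t) ^+ 2.
pose k0 := (4 * r)^-1.
have r4 : 0 < 4 * r by lra.
have kk0 : 0 < k - k0.
  rewrite subr_gt0 /k /k0 invf_plt ?posrE// ?divr_gt0 ?exprn_gt0//.
  by rewrite invf_div ltr_pdivrMr//; nra.
have p1 : pos (scal k0 - d * star d).
  (* This is [(c + r) ^ 2 - 4 r c = (c - r) ^ 2], divided by [4 r (c + r) ^ 2]. *)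
  have -> : scal k0 - d * star d = scal k0 * (w * w).
    have e1 : (c - scal r) * (c - scal r) = (c + scal r) * (c + scal r) - scal (4 * r) * c.
      have -> : scal (4 * r) = scal r + scal r + scal r + scal r.
        by rewrite -!scalD; congr (scal _); ring.
      have -> : (c + scal r) * (c + scal r) = (c - scal r) * (c - scal r)
         + (c * scal r + c * scal r + scal r * c + scal r * c) by ncring.
      rewrite scalC; ncring.
    have -> : w * w = g * ((c - scal r) * (c - scal r)) * g.
      have gw : (c - scal r) * g = g * (c - scal r).
        by rewrite mulrBl mulrBr gC scalC.
      have -> : g * ((c - scal r) * (c - scal r)) * g = w * ((c - scal r) * g).
        by rewrite /w; ncring.
      by rewrite gw.
    rewrite e1 mulrBr mulrBl.
    have -> : g * ((c + scal r) * (c + scal r)) * g = (g * (c + scal r)) * ((c + scal r) * g).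
      by ncring.
    rewrite gc cg mulr1 dd mulrBr mulr1; congr (_ - _).
    have -> : g * (scal (4 * r) * c) * g = (g * scal (4 * r)) * c * g by ncring.
    by rewrite scalC !mulrA -scalM mulVf ?gt_eqF// scal1 mul1r.
  by apply: pos_scalM; [rewrite invr_ge0 ltW | exact: pos_sqr].
have p2 : pos (star d * d + scal k0).
  have -> : star d * d + scal k0 = (star d * d + d * star d) + (scal k0 - d * star d).
    by ncring.
  by apply: pos_add => //; exact: pos_star_sum.
have i1 : invertible (scal k + d * star d).
  apply: invertible_add_swap.
    by rewrite /k mulf_neq0 ?invr_neq0 ?expf_neq0 ?gt_eqF.
  have -> : scal k + star d * d = star d * d + scal k0 + scal (k - k0).
    by rewrite scalB; ncring.
  exact: pos_invertible.
have cri : invertible (c + scal r) by exists g.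
have : invertible ((c + scal r) * (scal k + d * star d) * (c + scal r)).
  by do 2 apply: invertibleM => //.
set x := c + scal t.
have cx : c + scal r = x + scal (r - t) by rewrite /x scalB; ncring.
set y := scal k * (c + scal r) + scal (k * (r - t) + 1).
have -> : (c + scal r) * (scal k + d * star d) * (c + scal r) = x * y.
  rewrite dd; have -> : (c + scal r) * (scal k + g * c * g) * (c + scal r) =
     (c + scal r) * scal k * (c + scal r) + (c + scal r) * g * c * (g * (c + scal r)).
    by ncring.
  rewrite cg gc mul1r mulr1 /y.
  have cE : c = x - scal t by rewrite /x; ncring.
  rewrite [X in _ + X = _]cE.
  have -> : scal t = scal (k * (r - t)) * scal (r - t).
    by rewrite -scalM /k; congr (scal _); field; rewrite gt_eqF.
  rewrite cx [scal (_ + 1)]scalD scal1 [scal (k * _)]scalM.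
  set K := scal k; set T := scal (r - t).
  have -> : (x + T) * K * (x + T) + (x - K * T * T) =
    x * (K * (x + T) + (K * T + 1)) + (T * K * x - x * (K * T)) + (T * K - K * T) * T.
    by ncring.
  by rewrite /K /T -!scalM [k * _]mulrC scalC !subrr mul0r !addr0.
have xy : x * y = y * x.
  have xc : x * (c + scal r) = (c + scal r) * x by rewrite cx [LHS]mulrDr [RHS]mulrDl scalC.
  by rewrite [LHS]mulrDr [RHS]mulrDl mulrA (scalC k x) -mulrA xc mulrA (scalC _ x).
by move/invertible_mull; apply.
Qed.

(** For [t >= N c + 1] the element [c + scal t] is invertible by [neumann]. Each use of
    [mulstar_invertible_step] halves this threshold, so every [t > 0] is reached and
    [invertible_pos] concludes. *)
Lemma pos_mul_star a : pos (a * star a).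
Proof.
set c := a * star a.
have sc : star c = c by rewrite /c starM starK.
pose M := N c + 1.
have M0 : 0 < M by rewrite ltr_wpDl ?cnorm_ge0.
have step n t : M / 2 ^+ n <= t -> invertible (c + scal t).
  elim: n t => [|n ih] t.
    rewrite expr0 divr1 => Mt.
    have t0 : 0 < t := lt_le_trans M0 Mt.
    have -> : c + scal t = scal t * (1 - scal (- t^-1) * c).
      by rewrite mulrBr mulr1 mulrA -scalM mulrN mulfV ?gt_eqF// scalN scal1; ncring.
    apply: invertibleM; first by apply: invertible_scal; rewrite gt_eqF.
    apply: neumann; rewrite cnorm_scal normrN gtr0_norm ?invr_gt0//.
    by rewrite mulrC ltr_pdivrMr// mul1r (lt_le_trans _ Mt)// ltrDl.
  move=> ht; have [|tM] := leP (M / 2 ^+ n) t; first exact: ih.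
  apply: (@mulstar_invertible_step _ (M / 2 ^+ n)).
  - by rewrite divr_gt0// exprn_gt0.
  - by rewrite (ltW tM) andbT (le_trans _ ht)// exprSr invfM mulrA.
  - exact: ih.
apply: invertible_pos => // t t0.
have : (fun n => M * 2^-1 ^+ n) @ \oo --> M * 0.
  by apply: cvgMr; apply: cvg_expr; rewrite ger0_norm ?invr_ge0// invf_lt1// ltr1n.
rewrite mulr0 => /cvgrPdist_lt/(_ t t0)[n _ hn].
apply: (step n); have := hn n (leqnn n); rewrite /= sub0r normrN exprVn => h.
exact: le_trans (ler_norm _) (ltW h).
Qed.

(** With [s] the root of [p + d], conjugation of [s * s] has the form [x * star x]; the excess
    [d a (star a)] is at most [e] by the choice of [d]. *)
Lemma pos_conj a p : pos p -> pos (a * p * star a).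
Proof.
move=> pp; have sp := pos_star pp.
have saps : star (a * p * star a) = a * p * star a.
  by rewrite !starM starK sp mulrA.
apply: pos_closed => // e e0.
pose d := e / (N (a * star a) + 1).
have Na0 : 0 < N (a * star a) + 1 by rewrite ltr_wpDl ?cnorm_ge0.
have d0 : 0 < d by rewrite divr_gt0.
have [s [ss s2 _ _]] := pos_sqrt pp d0.
have -> : a * p * star a + scal e =
    (a * s) * star (a * s) + (scal e - scal d * (a * star a)).
  have -> : (a * s) * star (a * s) = a * (s * s) * star a.
    by rewrite starM ss; ncring.
  rewrite s2 mulrDr mulrDl scalC; ncring.
apply: pos_add; first exact: pos_mul_star.
apply: pos_scal_sub; first by rewrite star_scalM starM starK.
rewrite cnorm_scal gtr0_norm// /d mulrAC ler_pdivrMr// ler_pM2l//.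
by rewrite lerDl.
Qed.

Lemma pos_norm_mono p q : pos p -> pos (q - p) -> N p <= N q.
Proof.
move=> pp pqp; have pq : pos q by rewrite -(subrK p q); exact: pos_add.
apply: pos_norm_le; first exact: cnorm_ge0.
- have -> : scal (N q) - p = (scal (N q) - q) + (q - p) by ncring.
  by apply: pos_add => //; apply: pos_scal_sub => //; exact: pos_star.
- by apply: pos_add => //; apply: pos_scal; exact: cnorm_ge0.
Qed.

(** Here [p], [q], [u] stand for [<x, x>], [<y, y>], [<x, y>], and the hypothesis for positivity of
    [<x - c y, x - c y>]. Taking [c = u / t] with [t > N q] gives [u * star u <= t p]. The form
    covers Hilbert modules, finite sums and l2(A) at once. *)
Lemma cauchy_schwarz_pos u p q : star q = q ->
  (forall c, pos (p - u * star c - c * star u + c * q * star c)) ->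
  N u ^+ 2 <= N p * N q.
Proof.
move=> sq h.
have pp : pos p.
  by have := h 0; rewrite star0 !mulr0 !mul0r !subr0 addr0.
have key t : N q < t -> N u ^+ 2 <= t * N p.
  move=> qt; have t0 : 0 < t := le_lt_trans (cnorm_ge0 _) qt.
  rewrite -cnorm_mul_star.
  suff : pos (p - scal t^-1 * (u * star u)).
    have ti0 : 0 <= t^-1 by rewrite invr_ge0 ltW.
    move/(pos_norm_mono (pos_scalM ti0 (pos_mul_star u))).
    by rewrite cnorm_scal ger0_norm// ler_pdivrMl.
  pose c := scal t^-1 * u.
  have sc : star c = scal t^-1 * star u by rewrite star_scalM.
  have -> : p - scal t^-1 * (u * star u) =
     (p - u * star c - c * star u + c * q * star c) +
     (c * (scal t - q) * star c).
    have -> : p - u * star c - c * star u + c * q * star c +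
     (c * (scal t - q) * star c) = p - u * star c - c * star u + c * scal t * star c.
      by ncring.
    rewrite sc scalC /c [scal t * (_ * u)]mulrA -scalM mulfV ?gt_eqF// scal1 mul1r.
    ncring.
  apply: pos_add => //; apply: pos_conj; apply: pos_scal_sub => //; exact: ltW.
apply/ler_addgt0Pr => e e0.
have Np := cnorm_ge0 p.
have := key (N q + e / (N p + 1)) _; rewrite ltrDl divr_gt0 ?ltr_wpDl// => /(_ isT).
move=> /le_trans; apply; rewrite mulrDl [N p * _]mulrC lerD2l mulrAC.
by rewrite ler_pdivrMr ?ltr_wpDl// ler_pM2l// lerDl.
Qed.

(* Conjugating by [(p + e)^-1/2] turns a norm inequality into an order one. *)
Lemma pos_of_norm_conj p q r t : pos p -> star q = q -> 0 <= r < t ->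
  (forall a, N (a * q * star a) <= r * N (a * p * star a)) ->
  pos (scal t * p - q).
Proof.
move=> pp sq /andP[r0 rt] h; have sp := pos_star pp.
have t0 := le_lt_trans r0 rt.
apply: invertible_pos => [|l l0]; first by rewrite starB star_scalM sp sq.
(* With this shift, [t (p + l / t) = t p + l]. *)
have e0 : 0 < l / t by rewrite divr_gt0.
have [s [ss s2 [g [sg gs]] sc]] := pos_sqrt pp e0.
have stg := inverse_star ss sg gs.
have gpg : g * p * g = 1 - scal (l / t) * (g * g).
  have -> : p = s * s - scal (l / t) by rewrite s2 addrK.
  rewrite mulrBr mulrBl; have -> : g * (s * s) * g = (g * s) * (s * g) by ncring.
  by rewrite gs sg mulr1 scalC mulrA.
have Ngpg : N (g * p * star g) <= 1.
  rewrite stg gpg; apply: pos_norm_le => //; rewrite scal1.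
    rewrite opprB addrCA subrr addr0; apply: pos_scalM; first exact: ltW.
    exact: pos_sqr.
  by rewrite -gpg -{2}stg; apply: pos_add; [rewrite -scal1; exact: pos_scal|exact: pos_conj].
have Ngqg : N (g * q * g) < t.
  rewrite -{2}stg; apply: le_lt_trans (h g) _.
  by apply: le_lt_trans rt; rewrite ler_piMr.
have -> : scal t * p - q + scal l =
    scal t * (s * (1 - scal t^-1 * (g * q * g)) * s).
  have -> : s * (1 - scal t^-1 * (g * q * g)) * s =
      s * s - (s * scal t^-1) * g * q * (g * s) by ncring.
  rewrite scalC gs -[_ * s * g]mulrA sg !mulr1 s2 mulrBr mulrDr !mulrA -!scalM.
  rewrite mulfV ?gt_eqF// scal1 mul1r mulrC divfK ?gt_eqF//; ncring.
have si : invertible s by exists g.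
apply: invertibleM; first by apply: invertible_scal; rewrite gt_eqF.
do 2! apply: invertibleM => //; apply: neumann.
by rewrite cnorm_scal gtr0_norm ?invr_gt0// mulrC ltr_pdivrMr// mul1r.
Qed.

(** Some partial sum over a set containing [G] is within [e] of [l]; hence [l] minus the sum over
    [G], plus [e], is a sum of positive terms plus a positive remainder, and [pos_closed]
    applies. *)
Lemma pos_has_sum (J : countType) (x : J -> A) l (G : {fset J}) :
  (forall j, pos (x j)) -> has_sum x l -> pos (l - \sum_(j <- G) x j).
Proof.
move=> px /(has_sumP (@cnorm_complete R A)) h.
have sl : star l = l.
  apply: (norm_sub_eq (@cnorm_complete R A)) => e e0.
  have [F hF] := h _ (divr_gt0 e0 (ltr0n _ 2)).
  have := hF F (fsubset_refl F); set y := \sum_(j <- F) x j.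
  have sy : star y = y by apply/pos_star/pos_sum.
  have := norm_subD (@cnorm_complete R A) (star l) y l.
  rewrite -{1}sy -starB cnorm_starE (norm_sub (@cnorm_complete R A) l y); lra.
have pG := @pos_sum _ _ J _ x px.
apply: pos_closed => [|e e0]; first by rewrite starB sl (pos_star (pG G)).
have [F hF] := h e e0.
have := hF (fsetU G F) (fsubsetUr _ _).
have -> : fsetU G F = fsetU G (fsetD F G).
  by apply/fsetP => j; rewrite !inE; case: (j \in G).
rewrite sum_fsetU; last by apply/fdisjointP => j jG; rewrite inE jG.
set y := \sum_(j <- G) x j; set z := \sum_(j <- _) x j => hz.
have -> : l - y + scal e = z + (scal e - (y + z - l)) by ncring.
apply: pos_add; first exact: pG.
have [sy sz] : star y = y /\ star z = z by split; exact: pos_star (pG _).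
by apply: pos_scal_sub; [rewrite starB starD sl sy sz | exact: ltW].
Qed.

End PositiveProducts.

(** * Hilbert modules *)

Section HilbertModules.
Context (R : realType) (A : cstarAlgType R) (H : hilbertModType A).
Implicit Types (f g h : H) (a : A).
Local Notation N := (@cnorm R A).
Local Notation scal := (@scal R A).

Lemma act0l f : (0 : A) *; f = 0.
Proof. by apply: (@addrI _ ((0 : A) *; f)); rewrite -actDl !addr0. Qed.

Lemma act0r a : a *; (0 : H) = 0.
Proof. by apply: (@addrI _ (a *; (0 : H))); rewrite -actDr !addr0. Qed.

Lemma innerNl f g : inner (- f) g = - inner f g.
Proof.
have h0 : inner 0 g = 0 by apply: (@addrI _ (inner 0 g)); rewrite -innerDl !addr0.
by apply: (@addrI _ (inner f g)); rewrite -innerDl !subrr.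
Qed.

Lemma innerBl f g h : inner (f - g) h = inner f h - inner g h.
Proof. by rewrite innerDl innerNl. Qed.

Lemma inner0l g : inner 0 g = 0.
Proof. by rewrite -(subrr g) innerBl subrr. Qed.

Lemma innerBr f g h : inner h (f - g) = inner h f - inner h g.
Proof. by rewrite inner_star innerBl starB -!inner_star. Qed.

Lemma inner_actr a f g : inner f (a *; g) = inner f g * star a.
Proof. by rewrite inner_star inner_act starM -inner_star. Qed.

Lemma inner_ext f g : (forall h, inner f h = inner g h) -> f = g.
Proof.
move=> e; apply/eqP; rewrite -subr_eq0; apply/eqP/inner_eq0.
by rewrite innerBl e subrr.
Qed.

Lemma inner_pos f : pos (inner f f).
Proof. exact/cstar_nnegP/inner_nneg. Qed.

Definition hnorm f : R := Num.sqrt (N (inner f f)).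

Lemma hnorm_ge0 f : 0 <= hnorm f. Proof. exact: sqrtr_ge0. Qed.

Lemma hnorm_sqr f : hnorm f ^+ 2 = N (inner f f).
Proof. by rewrite sqr_sqrtr// cnorm_ge0. Qed.

Lemma hnormE f : `|f| = (hnorm f)%:C. Proof. exact: inner_norm. Qed.

Lemma hnorm_complete : complete_norm hnorm.
Proof.
have pos_real (e : R[i]) : 0 < e -> exists2 r : R, 0 < r & e = r%:C.
  by case: e => x y; rewrite ltcE/= => /andP[/eqP-> x0]; exists x.
split.
- by apply: complexI; rewrite -hnormE normr0.
- by move=> f h; apply/normr0_eq0; rewrite hnormE h.
- by move=> f g; rewrite -lecR rmorphD/= -!hnormE ler_normD.
- by move=> f; apply: complexI; rewrite -!hnormE normrN.
- move=> F l FF; split=> [/cvgrPdist_lt h e e0|h].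
    have := h e%:C; rewrite ltcR => /(_ e0); apply: filterS => x.
    by rewrite distrC hnormE ltcR.
  apply/cvgrPdist_lt => e /pos_real[r r0 ->].
  by have := h r r0; apply: filterS => x /=; rewrite distrC hnormE ltcR.
- move=> F PF h; suff /cvg_ex[l Fl] : cvg F by exists l.
  apply: cauchy_cvg; apply: cauchy_exP => e /pos_real[r r0 ->].
  have [x Fx] := h r r0; exists x.
  by move: Fx; apply: filterS => y /=; rewrite -ball_normE/= distrC hnormE ltcR.
Qed.

Lemma inner_cauchy_schwarz f g : N (inner f g) <= hnorm f * hnorm g.
Proof.
rewrite -(@ler_pXn2r _ 2)// ?nnegrE ?mulr_ge0 ?cnorm_ge0 ?hnorm_ge0//.
rewrite exprMn !hnorm_sqr; apply: cauchy_schwarz_pos => [|c].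
  exact: pos_star (inner_pos g).
have := inner_pos (f - c *; g).
rewrite innerBl !innerBr inner_act !inner_actr inner_act -inner_star.
by rewrite opprB addrA addrAC.
Qed.

Lemma hnorm_act a f : hnorm (a *; f) <= N a * hnorm f.
Proof.
rewrite -(@ler_pXn2r _ 2)// ?nnegrE ?mulr_ge0 ?cnorm_ge0 ?hnorm_ge0//.
rewrite exprMn !hnorm_sqr inner_act inner_actr mulrA.
rewrite (le_trans (cnormM _ _))// cnorm_starE expr2 mulrAC.
by rewrite ler_wpM2r ?cnorm_ge0// cnormM.
Qed.

(** If no uniform bound exists, nested balls can be built such that on each successive one some
    [p i] exceeds a larger integer; their common point contradicts the pointwise bound. *)
Lemma uniform_boundedness (I : Type) (p : I -> H -> R) (C : I -> R) :
  (forall i f g, p i (f + g) <= p i f + p i g) ->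
  (forall i f, p i (- f) = p i f) ->
  (forall i r f, 0 <= r -> p i (scal r *; f) = r * p i f) ->
  (forall i f, p i f <= C i * hnorm f) ->
  (forall f, exists M, forall i, p i f <= M) ->
  exists2 c, 0 <= c & forall i f, p i f <= c * hnorm f.
Proof.
move=> pD pN pZ pC pM; apply: contrapT => nbd.
have unbounded c : 0 <= c -> exists i f, c * hnorm f < p i f.
  move=> c0; apply: contrapT => nex; apply: nbd; exists c => // i f.
  by rewrite leNgt; apply/negP => lt; apply: nex; exists i, f.
have hZ r f : 0 <= r -> hnorm (scal r *; f) <= r * hnorm f.
  move=> r0; rewrite (le_trans (hnorm_act _ _))// ler_wpM2r ?hnorm_ge0//.
  by rewrite (le_trans (cnorm_scal_le _ _))// ger0_norm.
have pge0 i f : 0 <= p i f.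
  have := pD i f (- f); rewrite subrr pN.
  have := pZ i 0 0 (lexx 0); rewrite act0r mul0r => ->; lra.
(* A pair [(x, e)] encodes the ball of centre [x] and radius [2 e]. The new centre is within [e] and
   the new radius at most [e], so the balls are nested. *)
have hump (ns : nat * (H * R)) : exists s : H * R, 0 < ns.2.2 ->
    [/\ hnorm (s.1 - ns.2.1) <= ns.2.2, 0 < s.2, 2 * s.2 <= ns.2.2 &
      exists i, forall f, hnorm (f - s.1) <= 2 * s.2 -> ns.1%:R <= p i f].
  case: ns => n [x e] /=.
  have [e0|] := pselect (0 < e); last by exists (x, e).
  have c0 : 0 <= (n%:R + 1) / e by rewrite divr_ge0 ?addr_ge0// ltW.
  have [i [y hy]] := unbounded _ c0.
  have y0 : 0 < hnorm y.
    rewrite lt_neqAle hnorm_ge0 andbT; apply/negP => /eqP y0.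
    by have := pC i y; rewrite -y0 mulr0; move: hy; rewrite -y0 mulr0; lra.
  pose z := scal (e / hnorm y) *; y.
  have ey : 0 <= e / hnorm y by rewrite divr_ge0 ?hnorm_ge0// ltW.
  have hz : hnorm z <= e by rewrite (le_trans (hZ _ _ _))// divfK ?gt_eqF.
  have pz : n%:R + 1 <= p i z.
    rewrite /z pZ// mulrAC ler_pdivlMr// [e * _]mulrC.
    by move/ltW: hy; rewrite mulrAC ler_pdivrMr.
  (* By subadditivity [p i (x + z) + p i (x - z)] is at least [p i (2 z) >= 2 (n + 1)], so one of
     [x + z] and [x - z] will do. *)
  have [x' hx' px'] : exists2 x', hnorm (x' - x) <= e & n%:R + 1 <= p i x'.
    have [px|px] := leP (n%:R + 1) (p i (x + z)).
      by exists (x + z) => //; rewrite addrC addKr.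
    exists (x - z); first by rewrite addrC addKr (norm_opp hnorm_complete).
    have := pD i (x + z) (- (x - z)); rewrite pN.
    have -> : x + z - (x - z) = z + z by rewrite opprB addrC addrA subrK.
    have -> : z + z = scal 2 *; z.
      by rewrite (_ : 2 = 1 + 1)// scalD scal1 actDl act1.
    rewrite pZ//; lra.
  have Ci : 0 < 2 * (`|C i| + 1) by rewrite mulr_gt0// ltr_wpDl.
  (* The first bound gives nesting; the second lets [p i] drop by at most 1 on the new ball, from
     [n + 1] to [n]. *)
  pose e' := Num.min (e / 2) (2 * (`|C i| + 1))^-1.
  have e'0 : 0 < e' by rewrite lt_min divr_gt0//= invr_gt0.
  have [e'e e'C] : 2 * e' <= e /\ 2 * e' * (`|C i| + 1) <= 1.
    split; first by rewrite mulrC -ler_pdivlMr// ge_min lexx.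
    by rewrite -mulrA mulrCA -ler_pdivlMr// mul1r ge_min lexx orbT.
  exists (x', e') => _; split => //=; exists i => f hf.
  have := pD i f (x' - f); rewrite addrC subrK.
  have := pC i (x' - f); rewrite (norm_sub hnorm_complete).
  have := hnorm_ge0 (f - x').
  have : C i * hnorm (f - x') <= `|C i| * hnorm (f - x').
    by rewrite ler_wpM2r ?hnorm_ge0 ?ler_norm.
  have := normr_ge0 (C i); nra.
have [step hstep] := choice hump.
pose u := fix u n := if n is n'.+1 then step (n', u n') else (0, 1).
have e0 n : 0 < (u n).2.
  by elim: n => [|n ih] /=; [exact: ltr01 | have [] := hstep (n, u n) ih].
have uS n : [/\ hnorm ((u n.+1).1 - (u n).1) <= (u n).2, 0 < (u n.+1).2,
    2 * (u n.+1).2 <= (u n).2 & exists i, forall f,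
    hnorm (f - (u n.+1).1) <= 2 * (u n.+1).2 -> n%:R <= p i f].
  exact: hstep (n, u n) (e0 n).
have u0 : (u 0%N).2 = 1 by [].
clearbody u.
(* Telescoping; the term [- 2 * (u m).2] makes the induction close. *)
have near m n : (n <= m)%N -> hnorm ((u m).1 - (u n).1) <= 2 * (u n).2 - 2 * (u m).2.
  move=> /subnKC <-; elim: (m - n)%N => [|k ih].
    by rewrite addn0 !subrr (norm_zero hnorm_complete).
  rewrite addnS; have [+ _ + _] := uS (n + k)%N.
  have := norm_subD hnorm_complete (u (n + k).+1).1 (u (n + k)%N).1 (u n).1.
  lra.
have small n : (u n).2 <= 2^-1 ^+ n.
  elim: n => [|n ih]; first by rewrite expr0 u0.
  by rewrite exprS; have [_ _ + _] := uS n; lra.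
have [|l ul] := @seq_cauchy_lim _ _ _ hnorm_complete (fun n => (u n).1).
  move=> e ep.
  have : (fun n => 2 * 2^-1 ^+ n : R) @ \oo --> (2 * 0 : R).
    by apply: cvgMr; apply: cvg_expr; rewrite ger0_norm ?invr_ge0// invf_lt1// ltr1n.
  rewrite mulr0 => /cvgrPdist_lt/(_ e ep)[n _ hn]; exists n => m nm.
  have := hn n (leqnn n); rewrite /= sub0r normrN => /(le_lt_trans (ler_norm _)).
  have := near _ _ nm; have := small n; have := e0 m; lra.
have [M hM] := pM l.
have [n Mn] : exists n : nat, M < n%:R.
  by exists (Num.truncn M).+1; rewrite truncnS_gt.
have [_ _ _ [i hi]] := uS n.
have := hM i; apply/negP; rewrite -ltNge (lt_le_trans Mn)// hi//.
apply/ler_addgt0Pr => e ep; have [k hk] := ul e ep.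
have := hk _ (leq_maxl k n.+1); have := near _ _ (leq_maxr k n.+1).
have := e0 (maxn k n.+1).
have := norm_subD hnorm_complete l (u (maxn k n.+1)).1 (u n.+1).1.
rewrite (norm_sub hnorm_complete l (u (maxn k n.+1)).1); lra.
Qed.

End HilbertModules.

(** * The module l2(A) *)

Section EllTwoTheory.
Context (R : realType) (A : cstarAlgType R) (J : countType).
Implicit Types (a b : J -> A) (F : {fset J}).
Local Notation N := (@cnorm R A).
Local Notation hA := (@cnorm_complete R A).

Lemma finite_cauchy_schwarz F a b :
  N (\sum_(j <- F) a j * star (b j)) ^+ 2 <=
  N (\sum_(j <- F) a j * star (a j)) * N (\sum_(j <- F) b j * star (b j)).
Proof.
have star_sum (x : J -> A) : star (\sum_(j <- F) x j) = \sum_(j <- F) star (x j).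
  by apply: (big_morph (@star R A)); [exact: starD | exact: star0].
apply: cauchy_schwarz_pos => [|c].
  by rewrite star_sum; apply: eq_bigr => j _; rewrite starM starK.
have -> : \sum_(j <- F) a j * star (a j) - (\sum_(j <- F) a j * star (b j)) * star c
    - c * star (\sum_(j <- F) a j * star (b j))
    + c * (\sum_(j <- F) b j * star (b j)) * star c =
    \sum_(j <- F) (a j - c * b j) * star (a j - c * b j).
  rewrite star_sum !mulr_sumr !mulr_suml -!sumrB -big_split; apply: eq_bigr => j _ /=.
  rewrite starB !starM starK; ncring.
by apply: pos_sum => j; exact: pos_mul_star.
Qed.

Lemma has_sum_mull (x : J -> A) l c : has_sum x l -> has_sum (fun j => c * x j) (c * l).
Proof.
apply: (has_sum_lipschitz (phi := *%R c) hA hA _ _ (cnormM c)); last exact: mulr0.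
by move=> u v; rewrite mulrDr.
Qed.

Lemma has_sum_mulr (x : J -> A) l c : has_sum x l -> has_sum (fun j => x j * c) (l * c).
Proof.
apply: (has_sum_lipschitz (phi := *%R^~ c) (C := N c) hA hA); last 2 first.
- exact: mul0r.
- by move=> u; rewrite mulrC cnormM.
- by move=> u v; rewrite mulrDl.
Qed.

Lemma has_sum_star (x : J -> A) l : has_sum x l -> has_sum (fun j => star (x j)) (star l).
Proof.
apply: (has_sum_lipschitz (phi := @star R A) (C := 1) hA hA); last 2 first.
- exact: star0.
- by move=> u; rewrite cnorm_starE mul1r.
- by move=> u v; rewrite starD.
Qed.

(** By the finite Cauchy-Schwarz inequality, tails of the mixed sum are controlled by tails of the
    two diagonal ones. *)
Lemma l2_mul_converges a b : l2 A J a -> l2 A J b ->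
  converges (fun j => a j * star (b j)).
Proof.
move=> /(has_sum_cauchy hA) ca /(has_sum_cauchy hA) cb.
apply: (cauchy_has_sum hA) => e e0.
have [G hG] := ca e e0; have [G' hG'] := cb e e0.
exists (fsetU G G') => F; rewrite fdisjointUX => /andP[/hG ha /hG' hb].
rewrite -(@ltr_pXn2r _ 2)// ?nnegrE ?cnorm_ge0 ?ltW//.
apply: le_lt_trans (finite_cauchy_schwarz _ _ _) _.
by rewrite expr2 ltr_pM// cnorm_ge0.
Qed.

Lemma l2_inner_has_sum a b : l2 A J a -> l2 A J b ->
  has_sum (fun j => a j * star (b j)) (l2_inner a b).
Proof. by move=> la lb; apply: (converges_total hA); exact: l2_mul_converges. Qed.

Lemma l2_innerE a b l : has_sum (fun j => a j * star (b j)) l -> l2_inner a b = l.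
Proof. exact: (total_eq hA). Qed.

Lemma l2D a b : l2 A J a -> l2 A J b -> l2 A J (a + b).
Proof.
move=> la lb.
have h := has_sumD hA (has_sumD hA (l2_inner_has_sum la la) (l2_inner_has_sum la lb))
  (has_sumD hA (l2_inner_has_sum lb la) (l2_inner_has_sum lb lb)).
apply: (ex_intro _ _); move: h; congr (has_sum _ _).
by apply/funext => j /=; rewrite [(a + b) j]/(a j + b j) starD; ncring.
Qed.

Lemma l2_scale a c : l2 A J a -> l2 A J (fun j => c * a j).
Proof.
move=> la.
have h := has_sum_mulr (c := star c)
  (has_sum_mull (c := c) (l2_inner_has_sum la la)).
apply: (ex_intro _ _); move: h; congr (has_sum _ _).
by apply/funext => j /=; rewrite starM; ncring.
Qed.

Lemma l2_innerDl a b c : l2 A J a -> l2 A J b -> l2 A J c ->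
  l2_inner (a + b) c = l2_inner a c + l2_inner b c.
Proof.
move=> la lb lc; apply: l2_innerE.
have := has_sumD hA (l2_inner_has_sum la lc) (l2_inner_has_sum lb lc).
by congr (has_sum _ _); apply/funext => j; rewrite -mulrDl.
Qed.

Lemma l2_inner_scalel a b c : l2 A J a -> l2 A J b ->
  l2_inner (fun j => c * a j) b = c * l2_inner a b.
Proof.
move=> la lb; apply: l2_innerE.
have := has_sum_mull (c := c) (l2_inner_has_sum la lb).
by congr (has_sum _ _); apply/funext => j; rewrite mulrA.
Qed.

Lemma l2_inner_star a b : l2 A J a -> l2 A J b ->
  l2_inner a b = star (l2_inner b a).
Proof.
move=> la lb; apply: l2_innerE.
have := has_sum_star (l2_inner_has_sum lb la).
by congr (has_sum _ _); apply/funext => j; rewrite starM starK.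
Qed.

Lemma l2N a : l2 A J a -> l2 A J (- a).
Proof.
move=> la; have := l2_scale (-1) la; congr (l2 _ _ _).
by apply/funext => j; rewrite mulN1r.
Qed.

Lemma l2_innerBl a b c : l2 A J a -> l2 A J b -> l2 A J c ->
  l2_inner (a - b) c = l2_inner a c - l2_inner b c.
Proof.
move=> la lb lc; rewrite l2_innerDl//; last exact: l2N.
congr (_ + _); rewrite -[RHS]mulN1r -l2_inner_scalel//; congr (l2_inner _ _).
by apply/funext => j; rewrite mulN1r.
Qed.

Lemma l2_inner_pos a : l2 A J a -> pos (l2_inner a a).
Proof.
move=> la.
have := pos_has_sum fset0 (fun j => pos_mul_star (a j)) (l2_inner_has_sum la la).
by rewrite big_seq_fset0 subr0.
Qed.

Lemma l2_norm_ge0 a : 0 <= l2_norm a. Proof. exact: sqrtr_ge0. Qed.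

Lemma l2_norm_sqr a : l2_norm a ^+ 2 = N (l2_inner a a).
Proof. by rewrite sqr_sqrtr// cnorm_ge0. Qed.

Lemma l2_cauchy_schwarz a b : l2 A J a -> l2 A J b ->
  N (l2_inner a b) <= l2_norm a * l2_norm b.
Proof.
move=> la lb.
rewrite -(@ler_pXn2r _ 2)// ?nnegrE ?mulr_ge0 ?cnorm_ge0 ?l2_norm_ge0//.
rewrite exprMn !l2_norm_sqr; apply: cauchy_schwarz_pos => [|c].
  exact/pos_star/l2_inner_pos.
have lcb := l2_scale c lb; have lacb := l2D la (l2N lcb).
have := l2_inner_pos lacb; rewrite l2_innerBl// (l2_inner_star la lacb).
rewrite (l2_inner_star lcb lacb) !l2_innerBl// !l2_inner_scalel//.
rewrite !starB !starM -!l2_inner_star// !(l2_inner_scalel c lb)//.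
by congr (pos _); ncring.
Qed.

(** Apply Cauchy-Schwarz to [<b, b> = <a, b> - <a - b, b>] and divide by the norm of [b]. *)
Lemma l2_norm_triangle a b : l2 A J a -> l2 A J b ->
  l2_norm b <= l2_norm a + l2_norm (a - b).
Proof.
move=> la lb; have ld := l2D la (l2N lb).
have : l2_norm b ^+ 2 <= (l2_norm a + l2_norm (a - b)) * l2_norm b.
  rewrite l2_norm_sqr.
  have -> : l2_inner b b = l2_inner a b - l2_inner (a - b) b.
    by rewrite l2_innerBl// opprB addrC subrK.
  rewrite (le_trans (cnormB _ _))// mulrDl lerD// l2_cauchy_schwarz//.
have := l2_norm_ge0 b; rewrite le_eqVlt => /predU1P[<- _|b0].
  by rewrite addr_ge0 ?l2_norm_ge0.
by rewrite expr2 ler_pM2r.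
Qed.

Lemma l2_norm_scale a c : l2 A J a ->
  l2_norm (fun j => c * a j) ^+ 2 = N (c * l2_inner a a * star c).
Proof.
move=> la; have lc := l2_scale c la.
rewrite l2_norm_sqr l2_inner_scalel// l2_inner_star// l2_inner_scalel//.
by rewrite starM -l2_inner_star// mulrA.
Qed.

Lemma l2_basis_mul (j : J) b :
  has_sum (fun i => l2_basis A j i * star (b i)) (star (b j)).
Proof.
have -> : star (b j) = l2_basis A j j * star (b j) by rewrite /l2_basis eqxx mul1r.
apply: (has_sum_single hA (x := fun i => l2_basis A j i * star (b i))).
by move=> i ij; rewrite /l2_basis (negbTE ij) mul0r.
Qed.

Lemma l2_basis_l2 (j : J) : l2 A J (l2_basis A j).
Proof. by exists (star (l2_basis A j j)); exact: l2_basis_mul. Qed.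

End EllTwoTheory.

(** * The synthesis operator and its adjoint *)

Section Synthesis.
Context (R : realType) (A : cstarAlgType R) (H : hilbertModType A) (J : countType).
Variable f : J -> H.
Implicit Types (x y z : H) (a b : J -> A).
Local Notation N := (@cnorm R A).
Local Notation hA := (@cnorm_complete R A).
Local Notation hH := (@hnorm_complete R A H).

Definition analysis x : J -> A := fun j => inner x (f j).

Hypothesis f_bessel : star_bessel f.

Lemma analysis_l2 x : l2 A J (analysis x).
Proof.
have [B [_ /(_ x)[[l hl] _]]] := f_bessel.
by exists l; move: hl; congr (has_sum _ _); apply/funext => j; rewrite -inner_star.
Qed.

(** Finite partial sums lie below the total one because the terms are positive, and the norm is
    monotone on positive elements. *)
Lemma bessel_bound : exists2 M, 0 <= M & forall x (F : {fset J}),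
  N (\sum_(j <- F) analysis x j * star (analysis x j)) <= M * hnorm x ^+ 2.
Proof.
have [B [_ hB]] := f_bessel.
exists (N B ^+ 2) => [|x F]; first by rewrite exprn_ge0 ?cnorm_ge0.
have [cx lex] := hB x.
have hs : has_sum (fun j => analysis x j * star (analysis x j))
    (total (fun j => inner x (f j) * inner (f j) x)).
  have := converges_total hA cx; congr (has_sum _ _).
  by apply/funext => j; rewrite -inner_star.
have pj j := pos_mul_star (analysis x j).
apply: (@le_trans _ _ (N (B * inner x x * star B))).
  apply: pos_norm_mono; first exact: pos_sum.
  move/cstar_nnegP: lex => /pos_add/(_ (pos_has_sum F pj hs)).
  by rewrite addrA subrK.
rewrite hnorm_sqr (le_trans (cnormM _ _))// cnorm_starE expr2 mulrAC.
by rewrite ler_wpM2r ?cnorm_ge0// cnormM.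
Qed.

Lemma has_sum_inner (x : J -> H) y z : has_sum x y ->
  has_sum (fun j => inner (x j) z) (inner y z).
Proof.
apply: (has_sum_lipschitz (phi := inner^~ z) (C := hnorm z) hH hA); last 2 first.
- exact: inner0l.
- by move=> u; rewrite mulrC inner_cauchy_schwarz.
- by move=> u v; rewrite innerDl.
Qed.

(** For a finite partial sum [y], [<y, y>] is the sum of the [a j * star (analysis y j)].
    Cauchy-Schwarz and the Bessel bound give [|y| ^ 4 <= p M |y| ^ 2], with [p] the norm of the
    corresponding part of [<a, a>]; so the Cauchy criterion passes from [a] to the series. *)
Lemma synthesis_has_sum a : l2 A J a ->
  has_sum (fun j => a j *; f j) (synthesis f a).
Proof.
move=> la; apply: (converges_total hH); apply: (cauchy_has_sum hH) => e e0.
have [M M0 hM] := bessel_bound.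
have M1 : 0 < M + 1 by rewrite ltr_wpDl.
have e1 : 0 < e ^+ 2 / (M + 1) by rewrite divr_gt0 ?exprn_gt0.
have [G hG] := has_sum_cauchy hA la e1.
exists G => F /hG; rewrite ltr_pdivlMr// => hF.
set y := \sum_(j <- F) _.
have hy : hnorm y ^+ 2 = N (\sum_(j <- F) a j * star (analysis y j)).
  rewrite hnorm_sqr {1}/y; congr N.
  rewrite (big_morph (inner^~ y) (fun g h => innerDl g h y) (inner0l y)).
  by apply: eq_bigr => j _; rewrite inner_act -inner_star.
have := finite_cauchy_schwarz F a (analysis y); rewrite -hy => cs.
rewrite -(@ltr_pXn2r _ 2)// ?nnegrE ?hnorm_ge0 ?ltW//.
move: hF cs (hM y F); set p := N _; set q := N _; set u := hnorm y ^+ 2 => hF cs hq.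
have p0 : 0 <= p := cnorm_ge0 _.
have u0 : 0 <= u by rewrite exprn_ge0 ?hnorm_ge0.
move: u0; rewrite le_eqVlt => /predU1P[<-|u0]; first by rewrite exprn_gt0.
have : u * u <= p * M * u by rewrite -expr2 (le_trans cs)// -mulrA ler_wpM2l.
rewrite ler_pM2r// => /le_lt_trans; apply; nra.
Qed.

Lemma synthesis_adjoint : l2_is_adjoint (synthesis f) analysis.
Proof.
split=> [x|a x la]; first exact: analysis_l2.
symmetry; apply: l2_innerE.
have := has_sum_inner (z := x) (synthesis_has_sum la); congr (has_sum _ _).
by apply/funext => j; rewrite inner_act -inner_star.
Qed.

Lemma synthesis_basis j : synthesis f (l2_basis A j) = f j.
Proof.
apply: (total_eq hH).
have -> : f j = l2_basis A j j *; f j by rewrite /l2_basis eqxx act1.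
apply: (has_sum_single hH (x := fun i => l2_basis A j i *; f i)).
by move=> i ij; rewrite /l2_basis (negbTE ij) act0l.
Qed.

(** Pairing [S x] with the basis vector at [j] reads off the star of its coordinate at [j], which
    must therefore be [<f j, x>]. *)
Lemma l2_adjoint_unique L S : l2_is_adjoint L S ->
  (forall j, L (l2_basis A j) = f j) -> S = analysis.
Proof.
move=> [_ hS] hL; apply/funext => x; apply/funext => j.
have := hS _ x (l2_basis_l2 A j); rewrite hL (l2_innerE (@l2_basis_mul _ _ _ _ _)).
by move=> e; rewrite -[LHS]starK -e -inner_star.
Qed.

Lemma l2_adjoint_synthesis : l2_adjoint (synthesis f) = analysis.
Proof.
apply: xget_unique; first exact: synthesis_adjoint.
by move=> S hS; apply: l2_adjoint_unique hS _; exact: synthesis_basis.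
Qed.

Lemma synthesis_unique L a : l2_adjointable L ->
  (forall j, L (l2_basis A j) = f j) -> l2 A J a -> L a = synthesis f a.
Proof.
move=> [S adjL] hL la; apply: inner_ext => x.
have eS := l2_adjoint_unique adjL hL; move: adjL; rewrite eS => -[_ ->]//.
by have [_ ->] := synthesis_adjoint.
Qed.

End Synthesis.

(** * Inclusion of ranges *)

Section Adjointable.
Context (R : realType) (A : cstarAlgType R) (E F : hilbertModType A) (K : E -> F).
Hypothesis adjK : adjointable K.

(** [K] is a bare function: its linearity is deduced from the existence of an adjoint, by testing
    against inner products. *)
Lemma adjointableD : {morph K : x y / x + y}.
Proof.
have [K' hK] := adjK; move=> x y; apply: inner_ext => z.
by rewrite innerDl !hK innerDl.
Qed.

Lemma adjointable_act (a : A) : {morph K : x / a *; x}.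
Proof.
have [K' hK] := adjK; move=> x; apply: inner_ext => z.
by rewrite inner_act !hK inner_act.
Qed.

Lemma adjointableN : {morph K : x / - x}.
Proof.
have [K' hK] := adjK; move=> x; apply: inner_ext => z.
by rewrite innerNl !hK innerNl.
Qed.

End Adjointable.

(** * From the inclusion of ranges to an atomic system *)

Section RangeInclusion.
Context (R : realType) (A : cstarAlgType R) (H : hilbertModType A) (J : countType).
Variables (f : J -> H) (K : H -> H).
Hypothesis f_bessel : star_bessel f.
Hypothesis adjK : adjointable K.
Hypothesis range_le : forall x, exists2 a, l2 A J a & K x = synthesis f a.
Implicit Types (x y z : H) (a b : J -> A).
Local Notation N := (@cnorm R A).
Local Notation M := (l2_closure (range (@analysis R A H J f))).

(* If [K y = T b], then [<K y, z> = <b, T* z>] is bounded by [|b|] as long as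
   [|T* z| <= 1], so that uniform boundedness applies to these functionals. *)
Lemma analysis_dominates : exists2 c, 0 <= c &
  forall y z t, l2_norm (analysis f z) <= t -> 0 < t ->
    N (inner (K y) z) <= c * hnorm y * t.
Proof.
(* A positive upper bound [t] replaces the norm of [analysis f z], which may vanish, as the
   divisor. *)
pose I := {i : H * R | l2_norm (analysis f i.1) <= i.2 /\ 0 < i.2}.
pose p (i : I) y := N (inner (K y) (sval i).1) / (sval i).2.
have t0 (i : I) : 0 <= ((sval i).2)^-1 by case: i => -[z t] /= [_ /ltW]; rewrite invr_ge0.
have [K' hK] := adjK.
(* Each single functional is bounded because [<K y, z> = <y, K' z>]; this crude constant depends on
   [z]. *)
have [| | | | |c c0 hc] :=
  @uniform_boundedness R A H I p (fun i => hnorm (K' (sval i).1) / (sval i).2).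
- move=> i x y; rewrite /p -mulrDl ler_wpM2r// (adjointableD adjK) innerDl.
  exact: cnormD.
- by move=> i x; rewrite /p (adjointableN adjK) innerNl cnormN.
- move=> i r x r0; rewrite /p (adjointable_act adjK) inner_act cnorm_scal mulrA.
  by rewrite ger0_norm.
- move=> i x; rewrite /p mulrAC ler_wpM2r// hK mulrC.
  exact: inner_cauchy_schwarz.
- move=> y; have [b lb Ky] := range_le y.
  exists (l2_norm b) => -[[z t] /= [hz tp]]; rewrite /p /= ler_pdivrMr//.
  have [_ hT] := synthesis_adjoint f_bessel.
  rewrite Ky hT// (le_trans (l2_cauchy_schwarz _ _))//; first exact: analysis_l2.
  by rewrite ler_wpM2l ?l2_norm_ge0.
exists c => // y z t hz tp.
by have := hc (exist _ (z, t) (conj hz tp)) y; rewrite /p /= ler_pdivrMr.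
Qed.

Lemma closure_range_l2 a : M a -> l2 A J a. Proof. by case. Qed.

(** If [analysis f z] is within [e] of [a], then [<a, a>] is close to
    [<a, analysis f z> = <K y, z>], which [analysis_dominates] controls. Letting [e] tend to 0 and
    dividing by the norm of [a] gives the bound. *)
Lemma closure_range_bound : exists2 c, 0 <= c &
  forall a y, M a -> synthesis f a = K y -> l2_norm a <= c * hnorm y.
Proof.
have [c c0 hc] := analysis_dominates; exists c => // a y [la Ma] Ta.
have [_ hT] := synthesis_adjoint f_bessel.
have a0 := l2_norm_ge0 a; have y0 := hnorm_ge0 y.
have key e : 0 < e ->
    l2_norm a ^+ 2 <= c * hnorm y * (l2_norm a + e) + l2_norm a * e.
  move=> e0; have [_ [z _ <-] hz] := Ma e e0.
  have lz := analysis_l2 f_bessel z.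
  have ld := l2D la (l2N lz).
  have nz : l2_norm (analysis f z) <= l2_norm a + e.
    by rewrite (le_trans (l2_norm_triangle la lz))// lerD2l ltW.
  rewrite l2_norm_sqr.
  have -> : l2_inner a a = l2_inner a (analysis f z) + l2_inner a (a - analysis f z).
    rewrite (l2_inner_star la ld) l2_innerBl// starB -!l2_inner_star//; ncring.
  rewrite (le_trans (cnormD _ _))// lerD//.
    by rewrite -hT// Ta hc// ltr_wpDl.
  rewrite (le_trans (l2_cauchy_schwarz la ld))// ler_wpM2l// ltW//.
move: a0; rewrite le_eqVlt => /predU1P[<-|a0]; first exact: mulr_ge0.
rewrite -(@ler_pM2r _ (l2_norm a))// -expr2.
apply/ler_addgt0Pr => e e0.
(* With this [d] the error terms of [key d] add up to exactly [e]. *)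
pose d := e / (c * hnorm y + l2_norm a).
have s0 : 0 < c * hnorm y + l2_norm a by rewrite ltr_wpDl// mulr_ge0.
have d0 : 0 < d by rewrite divr_gt0.
have := key d d0; have : (c * hnorm y + l2_norm a) * d = e by rewrite mulrC divfK// gt_eqF.
lra.
Qed.

(** Stability under the action of [A] lets [closure_range_bound] be applied to all multiples of a
    pair, which upgrades a norm inequality to one between [A]-valued inner products. *)
Lemma closure_range_scale (c : A) a : M a -> M (fun j => c * a j).
Proof.
move=> [la Ma]; split; first exact: l2_scale.
move=> e e0; have Nc : 0 < N c + 1 by rewrite ltr_wpDl ?cnorm_ge0.
have [_ [z _ <-] hz] := Ma _ (divr_gt0 e0 Nc).
exists (analysis f (c *; z)); first by exists (c *; z).
have ld := l2D la (l2N (analysis_l2 f_bessel z)).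
have -> : (fun j => c * a j) - analysis f (c *; z) = (fun j => c * (a - analysis f z) j).
  apply/funext => j; rewrite /analysis -[LHS]/(c * a j - inner (c *; z) (f j)).
  by rewrite inner_act -mulrBr.
apply: le_lt_trans (_ : N c * l2_norm (a - analysis f z) < e).
  rewrite -(@ler_pXn2r _ 2)// ?nnegrE ?mulr_ge0 ?cnorm_ge0 ?l2_norm_ge0//.
  rewrite l2_norm_scale// exprMn (l2_norm_sqr (a - analysis f z)).
  rewrite (le_trans (cnormM _ _))// cnorm_starE expr2 mulrAC.
  by rewrite ler_wpM2r ?cnorm_ge0// cnormM.
move: hz; rewrite ltr_pdivlMr// => /(le_lt_trans _); apply.
by rewrite mulrC ler_wpM2l ?l2_norm_ge0// lerDl.
Qed.

Lemma synthesis_scale (c : A) a : l2 A J a ->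
  synthesis f (fun j => c * a j) = c *; synthesis f a.
Proof.
move=> la; have [_ hT] := synthesis_adjoint f_bessel.
apply: inner_ext => x; rewrite inner_act !hT//; last exact: l2_scale.
by rewrite l2_inner_scalel//; exact: analysis_l2.
Qed.

(** The component of a preimage orthogonal to the range of the adjoint is killed by [synthesis f],
    so the component in the closure is again a preimage. *)
Lemma closure_range_preimage x : l2_complemented M ->
  exists2 a, M a & synthesis f a = K x.
Proof.
move=> hM; have [b lb ->] := range_le x.
have [a [a' [Ma [la' orth] ba]]] := hM b lb.
exists a => //; apply: inner_ext => z.
have la := closure_range_l2 Ma.
have [_ hT] := synthesis_adjoint f_bessel; have lz := analysis_l2 f_bessel z.
rewrite !hT// ba l2_innerDl// orth ?addr0//; split=> // e e0.
exists (analysis f z); first by exists z.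
by rewrite /l2_norm (l2_innerBl lz lz (l2D lz (l2N lz))) subrr cnorm0 sqrtr0.
Qed.

Lemma range_le_atomic : l2_complemented M -> star_atomic_system K f.
Proof.
move=> hM; split=> //; have [c c0 hc] := closure_range_bound.
(* [pos_of_norm_conj] needs a constant strictly above [c ^+ 2]; the root of [k] becomes the [C] of
   the atomic system. *)
pose k := c ^+ 2 + 1.
have k0 : 0 < k by rewrite ltr_wpDl// exprn_ge0.
exists (scal A (Num.sqrt k)); split.
  have sk0 : Num.sqrt k != 0 by rewrite gt_eqF ?sqrtr_gt0.
  have [b [hb bh]] := invertible_scal A sk0.
  by apply; exists b; rewrite scale0r subr0.
move=> x; have [a Ma Ta] := closure_range_preimage x hM.
have la := closure_range_l2 Ma.
exists a; split=> //; first by rewrite -Ta; exact: synthesis_has_sum.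
apply/cstar_nnegP; rewrite star_scal scalC mulrA -scalM -expr2 sqr_sqrtr ?ltW//.
apply: (pos_of_norm_conj (r := c ^+ 2)) => [| | |e].
- exact: inner_pos.
- exact/pos_star/l2_inner_pos.
- by rewrite exprn_ge0//= ltrDl.
- rewrite -l2_norm_scale//.
  (* Conjugating by [e] replaces [x] by [e *; x] and [a] by its multiple, a pair to which the norm
     bound applies again. *)
  have -> : e * inner x x * star e = inner (e *; x) (e *; x).
    by rewrite inner_act inner_actr mulrA.
  rewrite -hnorm_sqr -exprMn ler_pXn2r ?nnegrE ?mulr_ge0 ?l2_norm_ge0 ?hnorm_ge0//.
  apply: hc; first exact: closure_range_scale.
  by rewrite synthesis_scale// Ta (adjointable_act adjK).
Qed.

End RangeInclusion.

Theorem theorem3p6 (R : realType) (A : cstarAlgType R) (H : hilbertModType A)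
    (J : countType) (K : H -> H) (f : J -> H) :
  finitely_generated H \/ countably_generated H ->
  adjointable K ->
  star_bessel f ->
  l2_complemented (l2_closure (range (l2_adjoint (synthesis f)))) ->
  star_atomic_system K f <->
  exists L : (J -> A) -> H,
    [/\ l2_adjointable L,
        forall j, L (l2_basis A j) = f j
      & range K `<=` L @` l2 A J].
Proof.
move=> _ adjK bf; rewrite l2_adjoint_synthesis// => hM; split.
- move=> [_ [C [_ hC]]]; exists (synthesis f); split.
  + by exists (analysis f); exact: synthesis_adjoint.
  + exact: synthesis_basis.
  + move=> _ [x _ <-]; have [a [la Ka _]] := hC x.
    by exists a => //; exact: (total_eq (@hnorm_complete R A H)).
- move=> [L [adjL Lf rKL]]; apply: range_le_atomic => // x.
  have [a la Lx] := rKL (K x) (imageT K x).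
  by exists a => //; rewrite -Lx; exact: synthesis_unique.
Qed.
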